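(* Let $X$ be a Banach space containing seminormalized basic sequences $(\underline{x}_i)_i$ and, for every $n\in\mathbb{N}$, $(x^n_i)_i$, such that $0<\inf_{n,i}\|x^n_i\|\le\sup_{n,i}\|x^n_i\|<\infty$. Let $(x_i)_i$ and $(z_i)_i$ be seminormalized basic sequences not necessarily in $X$. Assume: (1) the sequence $(\underline{x}_i)$ is dominated by the sequence $(x_i)$; (2) the sequence $(x_i)$ has a spreading model $(\tilde x_i)$ such that $(\tilde x_i)<<(z_i)$, and $(x_i)$ has Property P2; (3) there is a constant $C$ such that for every $n\in\mathbb{N}$ the sequence $(x^n_i)_i$ has a spreading model $(\tilde x^n_i)_i$ such that $(z_i)_{i=1}^n$ is $C$-dominated by $(\tilde x^n_i)_{i=1}^n$ ($C$ independent of $n$). Then there exist a closed subspace $Y$ of $X$ which has a basis and a bounded linear operator $T:Y\to X$ which is not a compact perturbation of a multiple of the inclusion map, i.e. there is no scalar $\lambda$ such that $T-\lambda i_{Y\to X}$ is compact, where $i_{Y\to X}$ is the inclusion map.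
   Context: Spreading model: a seminormalized basic sequence $(x_n)$ in a Banach space has spreading model $(\tilde x_n)$, a seminormalized basic sequence in some (possibly different) Banach space, if there is a sequence $\varepsilon_n\searrow0$ such that for all $n\in\mathbb{N}$, all scalars $(a_i)_{i=1}^n$ with $|a_i|\le1$, and all $n\le k_1<\dots<k_n$, $\left|\,\|\sum_{i=1}^n a_ix_{k_i}\|-\|\sum_{i=1}^n a_i\tilde x_i\|\,\right|<\varepsilon_n$. Domination on small coefficients: $c_{00}$ is the space of finitely supported scalar sequences. For seminormalized basic sequences $(x_n)$, $(z_n)$ (not necessarily in the same Banach space) and $\varepsilon>0$ let $\Delta_{(z_n),(x_n)}(\varepsilon)=\sup\{\|\sum a_ix_i\|:(a_i)\in c_{00},\ |a_i|\le\varepsilon\text{ for all }i,\ \|\sum a_iz_i\|\le1\}$. Write $(x_n)<<(z_n)$ if $\lim_{\varepsilon\searrow0}\Delta_{(z_n),(x_n)}(\varepsilon)=0$. A (finite or infinite) sequence $(u_i)$ is $C$-dominated by $(w_i)$ if $\|\sum a_iu_i\|\le C\|\sum a_iw_i\|$ for all finitely supported scalars $(a_i)$; it is dominated by $(w_i)$ if it is $C$-dominated for some $C$. Property P2: a seminormalized basic sequence $(z_i)$ has Property P2 if for every $\rho>0$ there exists $M=M(\rho)\in\mathbb{N}$ such that whenever $(a_i)$ are scalars with $\|\sum a_iz_i\|=1$, then $|\{i:|a_i|\ge\rho\}|\le M$. *)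

(* Defs.v *)
From HB Require Import structures.
From mathcomp Require Import all_boot all_order all_algebra.
From mathcomp Require Import complex.
From mathcomp Require Import all_classical all_reals all_analysis.

Set Implicit Arguments.
Unset Strict Implicit.
Unset Printing Implicit Defensive.

Import Order.TTheory GRing.Theory Num.Theory.
Import numFieldNormedType.Exports.

Local Open Scope classical_set_scope.
Local Open Scope ring_scope.

(** Banach spaces are taken over the reals ([cplx = false]) or over the complex
    numbers ([cplx = true]).  Sequences are indexed from 0, so [x i] is the
    vector usually written x_(i+1). *)
Definition scalars (R : realType) (cplx : bool) : numFieldType :=
  if cplx then (R[i] : numFieldType) else (R : numFieldType).

(** In MathComp-Analysis the norm of a [normedModType K] is [K]-valued (a real
    element of [K]); [rnorm] is the same norm, seen in [R].  It applies to
    scalars as well as to vectors. *)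
Definition real_part (R : realType) (cplx : bool) : scalars R cplx -> R :=
  match cplx as b return (scalars R b -> R) with
  | true => fun z : R[i] => complex.Re z
  | false => fun r : R => r
  end.

Definition rnorm (R : realType) (cplx : bool)
  (V : normedZmodType (scalars R cplx)) (v : V) : R := real_part `|v|.

Section SequencesInBanachSpaces.
Context {R : realType} {cplx : bool}.
Local Notation K := (scalars R cplx).
Implicit Types V W : completeNormedModType K.

Definition linear_subspace V (Y : set V) : Prop :=
  Y 0 /\ forall (a : K) (u v : V), Y u -> Y v -> Y (a *: u + v).

Definition closed_subspace V (Y : set V) : Prop :=
  linear_subspace Y /\ closed Y.

Definition closed_span V (x : nat -> V) : set V :=
  closure [set v | exists (n : nat) (a : 'I_n -> K),
                     v = \sum_(i < n) a i *: x i].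

Definition schauder_basis V (Y : set V) (e : nat -> V) : Prop :=
  (forall i, Y (e i)) /\
  forall y, Y y ->
    exists! a : nat -> K, series (fun i => a i *: e i) @ \oo --> y.

Definition basic_sequence V (x : nat -> V) : Prop :=
  schauder_basis (closed_span x) x.

Definition seminormalized V (x : nat -> V) : Prop :=
  exists c C : R, 0 < c /\ forall i, c <= rnorm (x i) <= C.

Definition seminormalized_basic V (x : nat -> V) : Prop :=
  basic_sequence x /\ seminormalized x.

(** With indices starting at 0, the condition n <= k_1 < ... < k_n becomes
    [n <= (k i).+1] for a strictly increasing [k]. *)
Definition spreading_model V W (x : nat -> V) (xt : nat -> W) : Prop :=
  [/\ seminormalized_basic x, seminormalized_basic xt &
      exists eps : nat -> R,
        [/\ nonincreasing_seq eps,
            eps @ \oo --> (0 : R) &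
            forall n : nat, (0 < n)%N ->
            forall (a : 'I_n -> K) (k : 'I_n -> nat),
              (forall i, rnorm (a i) <= 1) ->
              (forall i j : 'I_n, (i < j)%N -> (k i < k j)%N) ->
              (forall i, (n <= (k i).+1)%N) ->
              `| rnorm (\sum_(i < n) a i *: x (k i))
                 - rnorm (\sum_(i < n) a i *: xt i) | < eps n]].

Definition Delta V W (z : nat -> V) (x : nat -> W) (eps : R) : \bar R :=
  ereal_sup [set r : \bar R | exists (n : nat) (a : 'I_n -> K),
    [/\ forall i, rnorm (a i) <= eps,
        rnorm (\sum_(i < n) a i *: z i) <= 1 &
        r = (rnorm (\sum_(i < n) a i *: x i))%:E]].

(** [small_dominated x z] is x << z. *)
Definition small_dominated V W (x : nat -> V) (z : nat -> W) : Prop :=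
  Delta z x eps @[eps --> (0 : R)^'+] --> 0%E.

Definition fin_dominated V W (n : nat) (C : R) (u : nat -> V) (w : nat -> W) :
    Prop :=
  forall a : 'I_n -> K,
    rnorm (\sum_(i < n) a i *: u i) <= C * rnorm (\sum_(i < n) a i *: w i).

Definition dominated V W (u : nat -> V) (w : nat -> W) : Prop :=
  exists C : R, forall n, fin_dominated n C u w.

Definition property_P2 V (z : nat -> V) : Prop :=
  forall rho : R, 0 < rho -> exists M : nat,
    forall (a : nat -> K) (v : V),
      series (fun i => a i *: z i) @ \oo --> v -> rnorm v = 1 ->
      ([set i | rho <= rnorm (a i)] #<= `I_M)%card.

(** Operators defined on a subspace [Y] are represented by functions on the
    whole space, of which only the values on [Y] matter. *)
Definition bounded_linear_on V W (Y : set V) (T : V -> W) : Prop :=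
  (forall (a : K) (u v : V), Y u -> Y v -> T (a *: u + v) = a *: T u + T v) /\
  exists C : R, forall y, Y y -> rnorm (T y) <= C * rnorm y.

Definition compact_on V W (Y : set V) (T : V -> W) : Prop :=
  precompact (T @` [set y | Y y /\ rnorm y <= 1]).

End SequencesInBanachSpaces.

(* Main.v *)
Require Import Defs.
From HB Require Import structures.
From mathcomp Require Import all_boot all_order all_algebra.
From mathcomp Require Import complex.
From mathcomp Require Import all_classical all_reals all_analysis.
From Stdlib Require PeanoNat.
From mathcomp Require Import ring lra zify.

Set Implicit Arguments.
Unset Strict Implicit.
Unset Printing Implicit Defensive.

Import Order.TTheory GRing.Theory Num.Theory.
Import numFieldNormedType.Exports.

Local Open Scope classical_set_scope.
Local Open Scope ring_scope.

(** The idea of the proof.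

    Property P2 says that a unit vector of the span of (x_i) has few
    coefficients of any given size.  Cut the coefficients of such a vector into
    levels delta_(m+1) <= |a_i| < delta_m.  Up to the indices i < m, whose
    contribution is negligible when delta_m is small, the part of the vector on
    level m is a combination of boundedly many x_i far out, so that its norm is
    that of the same combination of the spreading model of x.  Since that
    spreading model is dominated by z on small coefficients, level m contributes
    at most a small multiple of the norm N_m of the same combination of z, and
    the smallness of the multiple beats any constant of order 2^m chosen
    beforehand.  Hence the norm in (x_i) is controlled by the sup of
    2^-m N_m over m, where N_m involves at most l_m coefficients, all of index
    at least m ([level_domination]).

    In X, spreading models of the rows dominate long initial segments of z.  So
    put y_i = sum_m 2^-m u_(i,m), where u_(i,m) is taken from a row whose
    spreading model is long enough for level m.  If restricting a combination
    of the y_i to one row m and to a set of at most l_m indices i >= m is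
    bounded uniformly, then 2^-m N_m is controlled by the norm in (y_i), and
    y_i |-> ux_i is bounded.

    That restriction property is a form of Schreier unconditionality, usually
    obtained for weakly null sequences.  It is available here without weak
    nullness: all sequences x, ux, z and the rows are replaced by differences of
    consecutive terms of subsequences, and this change preserves every
    hypothesis.  Let U be a free ultrafilter and, for pairs p = (j, k), let
    d_p = v_j - v_k.  If phi is a convex Lipschitz function then
    phi(Y) <= lim_p phi(Y + c d_p) along U tensor U, because the average of d_(i,j)
    and d_(j,k) is one half of d_(i,k), so that c may be halved repeatedly
    ([iterated_type_increasing]).  Applied to the iterated types
    Y |-> lim_(p_1) ... lim_(p_r) || Y + a_1 d_(p_1) + ... + a_r d_(p_r) ||, this
    shows that a vector can be dropped from a combination, even when it stands
    between vectors that are kept, without increasing the norm by more than a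
    small error.  Pairs chosen one after the other so that the iterated types are
    nearly attained have the restriction property ([selection]); with no
    vector kept at all, the same estimate bounds the basis constant of (y_i).

    Finally T maps y_i to ux_(kappa(2i)) - ux_(kappa(2i+1)) for even i and to 0 for odd i.
    If T - lambda i were compact, the separated sequence (y_i) with i odd would
    force lambda = 0, and then the images under T of the y_i with i even would
    have a cluster point.  The basis constant of (ux_i), which comes from
    Banach's theorem on bases ([basis_constant]), excludes this. *)

(** * The real-valued norm *)

Section RealNorm.
Context {R : realType} {cplx : bool}.
Local Notation K := (scalars R cplx).

Definition of_real : R -> K :=
  match cplx as b return (R -> scalars R b) with
  | true => fun r : R => (r%:C)%C
  | false => fun r : R => r
  end.

Lemma real_part_of_real (r : R) : real_part (of_real r) = r.
Proof. by rewrite /real_part /of_real; case: cplx. Qed.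

Lemma of_realM (r s : R) : of_real (r * s) = of_real r * of_real s.
Proof. by rewrite /of_real; case: cplx => //; rewrite rmorphM. Qed.

Lemma of_real0 : of_real 0 = 0.
Proof. by rewrite /of_real; case: cplx. Qed.

Lemma of_real1 : of_real 1 = 1.
Proof. by rewrite /of_real; case: cplx. Qed.

Lemma of_realD (r s : R) : of_real (r + s) = of_real r + of_real s.
Proof. by rewrite /of_real; case: cplx => //; rewrite rmorphD. Qed.

Lemma ler_of_real (r s : R) : (of_real r <= of_real s) = (r <= s).
Proof. by rewrite /of_real; case: cplx => //; rewrite lecR. Qed.

Lemma ltr_of_real (r s : R) : (of_real r < of_real s) = (r < s).
Proof. by rewrite /of_real; case: cplx => //; rewrite ltcR. Qed.

Lemma ge0_of_real (a : K) : 0 <= a -> a = of_real (real_part a).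
Proof.
rewrite /of_real /real_part; move: a; case: cplx => // -[a b].
by rewrite lecE /= => /andP[/eqP -> _].
Qed.

Lemma gt0_of_real (a : K) : 0 < a -> exists2 r, 0 < r & a = of_real r.
Proof.
move=> a0; have aE := ge0_of_real (ltW a0).
by exists (real_part a) => //; rewrite -ltr_of_real -aE of_real0.
Qed.

Lemma normr_rnorm (V : normedZmodType K) (v : V) : `|v| = of_real (rnorm v).
Proof. exact/ge0_of_real/normr_ge0. Qed.

Lemma normr_of_real (r : R) : `|of_real r| = of_real `|r|.
Proof. by rewrite /of_real; case: cplx => //; rewrite normc_def /= expr0n addr0 sqrtr_sqr. Qed.

Lemma rnorm_of_real (r : R) : rnorm (of_real r : K) = `|r|.
Proof. by rewrite /rnorm normr_of_real real_part_of_real. Qed.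

Section Vectors.
Context {V : normedZmodType K}.
Implicit Types u v w : V.

Lemma rnorm_ge0 v : 0 <= rnorm v.
Proof. by rewrite -ler_of_real of_real0 -normr_rnorm normr_ge0. Qed.

Lemma rnormD u v : rnorm (u + v) <= rnorm u + rnorm v.
Proof. by rewrite -ler_of_real of_realD -!normr_rnorm ler_normD. Qed.

Lemma rnormN v : rnorm (- v) = rnorm v.
Proof. by rewrite /rnorm normrN. Qed.

Lemma rnorm_distC u v : rnorm (u - v) = rnorm (v - u).
Proof. by rewrite /rnorm distrC. Qed.

Lemma rnormB u v : rnorm (u - v) <= rnorm u + rnorm v.
Proof. by rewrite (le_trans (rnormD _ _))// rnormN. Qed.

Lemma rnorm0 : rnorm (0 : V) = 0.
Proof. by rewrite /rnorm normr0 -of_real0 real_part_of_real. Qed.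

Lemma rnorm_eq0 v : (rnorm v == 0) = (v == 0).
Proof.
apply/eqP/eqP => [v0|->]; last exact: rnorm0.
by apply/eqP; rewrite -normr_eq0 normr_rnorm v0 of_real0.
Qed.

Lemma rnorm_gt0 v : (0 < rnorm v) = (v != 0).
Proof. by rewrite lt_def rnorm_eq0 rnorm_ge0 andbT. Qed.

Lemma rnorm_triangle u v w : rnorm (u - w) <= rnorm (u - v) + rnorm (v - w).
Proof. by rewrite (le_trans _ (rnormD _ _))// addrA subrK. Qed.

Lemma rnormBl u v : rnorm u - rnorm v <= rnorm (u - v).
Proof. by rewrite lerBlDr (le_trans _ (rnormD _ _))// subrK. Qed.

Lemma rnorm_sum (I : Type) (r : seq I) (P : pred I) (F : I -> V) :
  rnorm (\sum_(i <- r | P i) F i) <= \sum_(i <- r | P i) rnorm (F i).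
Proof.
elim/big_ind2: _ => [||//]; first by rewrite rnorm0.
by move=> ? ? ? ? h1 h2; rewrite (le_trans (rnormD _ _))// lerD.
Qed.

End Vectors.

Lemma rnormZ (V : normedModType K) (a : K) (v : V) :
  rnorm (a *: v) = rnorm a * rnorm v.
Proof.
by apply/eqP; rewrite eq_le -!ler_of_real of_realM -!normr_rnorm normrZ lexx.
Qed.

Lemma rnorm1 : rnorm (1 : K) = 1.
Proof. by rewrite -of_real1 rnorm_of_real normr1. Qed.

(** Convergence, closures and completeness in terms of the real-valued norm, so
    that the rest of the argument does not distinguish the two scalar fields. *)
Lemma cvg_rnormP (V : normedModType K) (T : Type) (F : set_system T)
    (FF : Filter F) (f : T -> V) (l : V) :
  (f @ F --> l) <-> forall e : R, 0 < e -> F [set t | rnorm (f t - l) < e].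
Proof.
split=> [fl e e0|H].
  have e0' : 0 < of_real e by rewrite -of_real0 ltr_of_real.
  move/cvgrPdist_lt : fl => /(_ _ e0'); apply: filterS => t /=.
  by rewrite normr_rnorm ltr_of_real rnorm_distC.
apply/cvgrPdist_lt => e e0.
have [r r0 ->] := gt0_of_real e0.
apply: filterS (H _ r0) => t /=.
by rewrite normr_rnorm ltr_of_real rnorm_distC.
Qed.

Lemma closure_rnormP (V : normedModType K) (A : set V) (v : V) :
  closure A v <-> forall e : R, 0 < e -> exists2 a, A a & rnorm (v - a) < e.
Proof.
split=> [Av e e0|H B /nbhs_ballP[e /= e0 eB]].
  have e0' : 0 < of_real e by rewrite -of_real0 ltr_of_real.
  have [a [Aa]] := Av _ (nbhsx_ballx v (of_real e) e0').
  rewrite -ball_normE /ball_ /= normr_rnorm ltr_of_real => ?; by exists a.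
have [r r0 eE] := gt0_of_real e0; rewrite eE in eB.
have [a Aa va] := H _ r0.
exists a; split => //; apply: eB.
by rewrite -ball_normE /ball_ /= normr_rnorm ltr_of_real.
Qed.

Lemma cauchy_rnorm_cvg (V : completeNormedModType K) (s : nat -> V) :
  (forall e : R, 0 < e -> exists N, forall m n, (N <= m)%N -> (N <= n)%N ->
     rnorm (s m - s n) < e) -> exists l : V, s @ \oo --> l.
Proof.
move=> H; suff /cauchy_cvg : cauchy (s @ \oo) by move=> ?; exists (lim (s @ \oo)).
apply: cauchy_exP => e e0.
have [r r0 ->] := gt0_of_real e0.
have [N HN] := H _ r0.
exists (s N); exists N => // n /= Nn; rewrite -ball_normE /ball_ /= normr_rnorm ltr_of_real.
by apply: HN => //; rewrite leqnn.
Qed.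

End RealNorm.

(** * Limits along ultrafilters *)

Section Ultralimits.
Context {R : realType} {cplx : bool}.
Local Notation K := (scalars R cplx).
Context {P : Type} (W : set_system P) {WU : UltraFilter W}.

Lemma ultra_cvg (h : P -> R) (B : R) : (forall p, `|h p| <= B) ->
  cvg (h @ W).
Proof.
move=> hB; have := @segment_compact R (- B) B; rewrite compact_ultra => /(_ (h @ W)).
case.
- split; first exact: fmap_proper_filter.
  move=> G GG WG; rewrite eqEsubset; split => // A GA.
  have [//|WnA] := in_ultra_setVsetC (h @^-1` A) WU.
  have /WG GnA : (h @ W) (~` A) by [].
  have GAA : G (A `&` ~` A).
    by apply: filterI; [exact: GA|exact: GnA].
  by have [x [Ax nAx]] := filter_ex GAA; case: (nAx Ax).
- by apply: (@filterE _ W) => p; rewrite /= in_itv/= -ler_norml; exact: hB.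
- by move=> l [_ hl]; apply/cvg_ex; exists l.
Qed.

Lemma ultra_cvgP (h : P -> R) (B e : R) : (forall p, `|h p| <= B) -> 0 < e ->
  W [set p | `|h p - lim (h @ W)| < e].
Proof.
move=> hB e0; have /cvgrPdist_lt /(_ _ e0) := ultra_cvg hB.
by apply: filterS => p /=; rewrite distrC.
Qed.

(** Bounded sets of scalars are relatively compact; the limit is stated with
    [rnorm] in order to treat real and complex scalars together. *)
Lemma ultra_cvg_scalars (f : P -> K) (B : R) : (forall p, rnorm (f p) <= B) ->
  exists l : K, forall e : R, 0 < e -> W [set p | rnorm (f p - l) < e].
Proof.
rewrite /rnorm /real_part; move: f; case: cplx => f fB.
- have fRe p : `|complex.Re (f p)| <= B.
    by apply: le_trans (fB p); case: (f p) => a b /=;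
      rewrite -sqrtr_sqr ler_sqrt ?addr_ge0 ?sqr_ge0// lerDl sqr_ge0.
  have fIm p : `|complex.Im (f p)| <= B.
    by apply: le_trans (fB p); case: (f p) => a b /=;
      rewrite -sqrtr_sqr ler_sqrt ?addr_ge0 ?sqr_ge0// lerDr sqr_ge0.
  exists (Complex (lim ((fun p => complex.Re (f p)) @ W)) (lim ((fun p => complex.Im (f p)) @ W))).
  move=> e e0; have e20 : 0 < e / 2 by rewrite divr_gt0.
  apply: filterS (filterI (ultra_cvgP fRe e20) (ultra_cvgP fIm e20)) => p /=.
  case: (f p) => a b /= [ha hb].
  have -> : e = e / 2 + e / 2 by rewrite -splitr.
  apply: le_lt_trans (ltrD ha hb).
  rewrite -[leRHS]ger0_norm ?addr_ge0// -sqrtr_sqr ler_sqrt ?sqr_ge0//.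
  rewrite [leRHS]sqrrD !real_normK ?num_real// addrAC lerDl.
  by rewrite mulrn_wge0 ?mulr_ge0.
- exists (lim (f @ W)) => e e0; exact: ultra_cvgP fB e0.
Qed.

(** Otherwise a bad parameter a(p) exists for almost all p; the ultralimit of
    the a(p) is a single parameter at which pointwise convergence fails, by the
    common Lipschitz constant. *)
Lemma ultra_cvg_uniform (h : P -> (nat -> K) -> R) (l : (nat -> K) -> R)
    (N : nat) (L : R) :
  let lipschitz (g : (nat -> K) -> R) := forall (a b : nat -> K) (d : R),
    (forall i, (i < N)%N -> rnorm (a i - b i) <= d) -> 0 <= d ->
    `|g a - g b| <= L * d in
  (forall p, lipschitz (h p)) -> lipschitz l ->
  (forall a (e : R), 0 < e -> W [set p | `|h p a - l a| < e]) ->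
  forall e : R, 0 < e -> W [set p | forall a : nat -> K,
    (forall i, (i < N)%N -> rnorm (a i) <= 1) -> `|h p a - l a| <= e].
Proof.
move=> lipschitz hL lL hl e e0.
set A := (X in W X).
have [//|WnA] := in_ultra_setVsetC A WU.
have bad p : exists a : nat -> K, (forall i, rnorm (a i) <= 1) /\
    ((~` A) p -> e < `|h p a - l a|).
  have [Ap|nAp] := pselect (A p).
    by exists (fun=> 0); split => // i; rewrite rnorm0.
  move: (nAp) => /existsNP[a /not_implyP[a1 /negP]]; rewrite -ltNge => ea.
  pose a' i := if (i < N)%N then a i else 0.
  exists a'; split.
    by rewrite /a' => i; case: ifPn => [/a1//|_]; rewrite rnorm0.
  move=> _; have eqa g : lipschitz g -> g a = g a'.
    move=> gL; apply/eqP; rewrite -subr_eq0 -normr_le0.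
    rewrite (le_trans (gL a a' 0 _ _)) ?mulr0// => i iN.
    by rewrite /a' iN subrr rnorm0.
  by rewrite -(eqa _ (hL p)) -(eqa _ lL).
have [a /all_and2[a1 abad]] := choice bad.
have lims i : exists li : K, forall d : R, 0 < d -> W [set p | rnorm (a p i - li) < d].
  by apply: (@ultra_cvg_scalars _ 1) => p; exact: a1.
have [b ab] := choice lims.
pose d := e / 3 / (`|L| + 1).
have d0 : 0 < d by rewrite !divr_gt0// ltr_wpDl.
have Ld : L * d <= e / 3.
  rewrite /d mulrCA ler_piMr//; first by rewrite divr_ge0// ltW.
  by rewrite ler_pdivrMr ?ltr_wpDl// mul1r (le_trans (ler_norm _))// lerDl.
have Wd : W [set p | forall i : 'I_N, rnorm (a p i - b i) < d].
  by apply: filter_forall => i; exact: ab.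
have e30 : 0 < e / 3 by rewrite divr_gt0.
have [p [[pA pd] pb]] := filter_ex (filterI (filterI WnA Wd) (hl b _ e30)).
have /= := abad _ pA; rewrite ltNge => /negP[].
have pd' i : (i < N)%N -> rnorm (a p i - b i) <= d.
  by move=> iN; exact: ltW (pd (Ordinal iN)).
have h1 := le_trans (hL p (a p) b d pd' (ltW d0)) Ld.
have h2 := le_trans (lL (a p) b d pd' (ltW d0)) Ld.
move: h1 h2 (ltW pb) => /=; rewrite !ler_norml => /andP[? ?] /andP[? ?] /andP[? ?].
by apply/andP; split; lra.
Qed.

End Ultralimits.

Section PairFilter.

(** The tensor square of U: a property holds for almost all pairs when it holds
    for U-almost all j and then U-almost all k depending on j. *)
Definition pair_filter (U : set_system nat) : set_system (nat * nat) :=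
  [set A | U [set j | U [set k | A (j, k)]]].

Lemma pair_filter_ultra (U : set_system nat) :
  UltraFilter U -> UltraFilter (pair_filter U).
Proof.
move=> UU; have WP : ProperFilter (pair_filter U).
  apply: Build_ProperFilter_ex.
    move=> A UA; have [j Uj] := @filter_ex _ U _ _ UA.
    by have [k Ajk] := @filter_ex _ U _ _ Uj; exists (j, k).
  split.
  - by apply: (@filterE _ U) => j; exact: (@filterT _ U).
  - move=> A B UA UB; apply: (filterS _ (@filterI _ U _ _ _ UA UB)) => j [Aj Bj].
    exact: (@filterI _ U).
  - move=> A B AB; apply: (@filterS _ U) => j; apply: (@filterS _ U) => k; exact: AB.
split=> // G GG WG; rewrite eqEsubset; split => // A GA.
suff [//|WnA] : pair_filter U A \/ pair_filter U (~` A).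
  have GAA : G (A `&` ~` A) by exact: (@filterI _ G _ _ _ GA (WG _ WnA)).
  by have [x [Ax nAx]] := filter_ex GAA; case: (nAx Ax).
have [?|UnA] := in_ultra_setVsetC [set j | U [set k | A (j, k)]] UU; first by left.
right; apply: (@filterS _ U) UnA => j /= njA.
by have [//|//] := in_ultra_setVsetC [set k | A (j, k)] UU.
Qed.

Lemma free_ultrafilter_nat : exists U : set_system nat,
  UltraFilter U /\ forall n, U [set k | (n < k)%N].
Proof.
have [U [UU sU]] := @ultraFilterLemma nat eventually _.
by exists U; split => // n; apply: sU; exists n.+1.
Qed.

End PairFilter.

(** * Iterated types *)

Lemma half_pow_lt (R : realType) (e : R) : 0 < e -> exists n, 2^-1 ^+ n < e.
Proof.
have h0 : `|2^-1 : R| < 1 by rewrite ger0_norm ?invr_ge0//; lra.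
move=> e0; have /cvgrPdist_lt /(_ _ e0)[n _ /(_ n (leqnn _))] := cvg_expr h0.
by rewrite /= sub0r normrN ger0_norm ?exprn_ge0 ?invr_ge0// => h; exists n.
Qed.

Section IteratedTypes.
Context {R : realType} {cplx : bool}.
Local Notation K := (scalars R cplx).
Context {X : completeNormedModType K} (v : nat -> nat -> X) (B : R).
Hypothesis vB : forall m j, rnorm (v m j) <= B.
Context (U : set_system nat) {UU : UltraFilter U}.
Let W := pair_filter U.
Let WU : UltraFilter W := pair_filter_ultra UU.
#[local] Existing Instance WU.

Definition pair_diff (m : nat) (p : nat * nat) : X := v m p.1 - v m p.2.

(** The function Y |-> lim_(p_1) ... lim_(p_r) || Y + c_1 d_1 + ... + c_r d_r ||,
    with d_s the difference of the row m_s at the pair p_s, for the word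
    (m_1, c_1) ... (m_r, c_r): a type in the sense of Krivine and Maurey. *)
Fixpoint iterated_type (w : seq (nat * K)) (Y : X) : R :=
  if w is (m, c) :: w' then
    lim ((fun p => iterated_type w' (Y + c *: pair_diff m p)) @ W)
  else rnorm Y.

Lemma pair_diff_le m p : rnorm (pair_diff m p) <= 2 * B.
Proof. by rewrite (le_trans (rnormB _ _))// mulr2n mulrDl mul1r lerD. Qed.

Let B0 : 0 <= B. Proof. exact: le_trans (rnorm_ge0 _) (vB 0 0). Qed.

Lemma iterated_type_cvg m (c : K) (phi : X -> R) (Y : X) (e : R) :
  (forall Y Y', phi Y <= phi Y' + rnorm (Y - Y')) -> 0 < e ->
  W [set p | `|phi (Y + c *: pair_diff m p)
               - lim ((fun p => phi (Y + c *: pair_diff m p)) @ W)| < e].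
Proof.
move=> phiL; apply: (@ultra_cvgP _ _ _ _ _ (`|phi Y| + rnorm c * (2 * B))) => p.
have d2 : rnorm (c *: pair_diff m p) <= rnorm c * (2 * B).
  by rewrite rnormZ ler_wpM2l ?rnorm_ge0 ?pair_diff_le.
have h1 := phiL (Y + c *: pair_diff m p) Y; rewrite (addrC Y) addrK in h1.
have h2 := phiL Y (Y + c *: pair_diff m p).
rewrite opprD addrA subrr add0r rnormN in h2.
rewrite (addrC _ Y) in h1.
have := ler_norm (phi Y); have := ler_norm (- phi Y); rewrite normrN => n1 n2.
by rewrite ler_norml; apply/andP; split; lra.
Qed.

Lemma iterated_type_lipschitz w (Y Y' : X) :
  iterated_type w Y <= iterated_type w Y' + rnorm (Y - Y').
Proof.
elim: w Y Y' => [|[m c] w IH] Y Y' /=; first by rewrite -lerBlDl rnormBl.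
apply/ler_addgt0Pr => e e0; have e20 : 0 < e / 2 by rewrite divr_gt0.
have [p [/= p1 p2]] := filter_ex (filterI (iterated_type_cvg m c Y IH e20)
  (iterated_type_cvg m c Y' IH e20)).
have := IH (Y + c *: pair_diff m p) (Y' + c *: pair_diff m p).
rewrite opprD addrACA subrr addr0.
move: p1 p2; rewrite !ltr_norml => /andP[? ?] /andP[? ?] ?; lra.
Qed.

(** Convexity passes from the norm to the limits.  The midpoint is written
    without division so that no scalar one half has to be transported. *)
Lemma iterated_type_midconvex w (Y S T : X) :
  2 * iterated_type w (Y + S + T)
    <= iterated_type w (Y + (S + S)) + iterated_type w (Y + (T + T)).
Proof.
elim: w Y S T => [|[m c] w IH] Y S T /=.
  have -> : 2 * rnorm (Y + S + T) = rnorm ((Y + (S + S)) + (Y + (T + T))).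
    rewrite -[in LHS](ger0_norm (ler0n _ 2)) -(@rnorm_of_real _ cplx) -rnormZ.
    rewrite of_realD !of_real1 scalerDl scale1r; congr rnorm.
    by rewrite [LHS]addrACA [in LHS](addrACA Y) [RHS]addrACA !addrA.
  exact: rnormD.
apply/ler_addgt0Pr => e e0; have e20 : 0 < e / 4 by rewrite divr_gt0.
have lip := iterated_type_lipschitz w.
have [p [/= p1 [p2 p3]]] := filter_ex (filterI (iterated_type_cvg m c (Y + S + T) lip e20)
  (filterI (iterated_type_cvg m c (Y + (S + S)) lip e20)
           (iterated_type_cvg m c (Y + (T + T)) lip e20))).
have := IH (Y + c *: pair_diff m p) S T.
rewrite !(addrAC _ (c *: pair_diff m p)).
move: p1 p2 p3; rewrite !ltr_norml => /andP[? ?] /andP[? ?] /andP[? ?] ?; lra.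
Qed.

(** With i, j, k increasing along the ultrafilter, d(i,k) = d(i,j) + d(j,k), so
    convexity bounds the value at c d(i,k) by the mean of the values at
    2 c d(i,j) and 2 c d(j,k).  This is the only place where differences of
    terms are needed instead of the terms themselves. *)
Lemma halve_coefficient w m (c : K) (Y : X) (L : R) :
  W [set p | iterated_type w (Y + (c + c) *: pair_diff m p) <= L] ->
  W [set p | iterated_type w (Y + c *: pair_diff m p) <= L].
Proof.
rewrite /W /pair_filter /= => WL; apply: (@filterS _ U) (WL) => i iL.
have [j [jL ij]] := @filter_ex _ U _ _ (@filterI _ U _ _ _ WL iL).
apply: (@filterS _ U) (jL) => k jk.
have := iterated_type_midconvex w Y (c *: pair_diff m (i, j)) (c *: pair_diff m (j, k)).
rewrite -!scalerDl -addrA -scalerDr.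
have -> : pair_diff m (i, j) + pair_diff m (j, k) = pair_diff m (i, k).
  by rewrite /pair_diff /= addrA subrK.
by move: ij jk => /= ? ? ?; lra.
Qed.

(** A difference far out can be dropped: halve its coefficient until the
    Lipschitz bound makes it negligible. *)
Lemma iterated_type_increasing w m (c : K) (Y : X) :
  iterated_type w Y <= iterated_type ((m, c) :: w) Y.
Proof.
set L := iterated_type (_ :: _) _.
apply/ler_addgt0Pr => e e0; have e20 : 0 < e / 2 by rewrite divr_gt0.
have WL (n : nat) :
    W [set p | iterated_type w (Y + (of_real (2^-1 ^+ n) * c) *: pair_diff m p) <= L + e / 2].
  elim: n => [|n IH].
    rewrite expr0 of_real1 mul1r.
    apply: filterS (iterated_type_cvg m c Y (iterated_type_lipschitz w) e20) => p /=.
    by rewrite ltr_norml -/L => /andP[_ h]; rewrite -lerBlDl ltW.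
  apply: halve_coefficient; rewrite -mulrDl -of_realD exprS.
  by have -> : 2^-1 * 2^-1 ^+ n + 2^-1 * 2^-1 ^+ n = 2^-1 ^+ n :> R by field.
pose D := rnorm c * (2 * B) + 1.
have D0 : 0 < D by rewrite ltr_wpDl// mulr_ge0 ?rnorm_ge0 ?mulr_ge0.
have [n nD] : exists n, 2^-1 ^+ n * D <= e / 2.
  have [n] := half_pow_lt (divr_gt0 e20 D0).
  by rewrite ltr_pdivlMr// => h; exists n; exact: ltW.
have [p /= pL] := filter_ex (WL n).
have := iterated_type_lipschitz w Y (Y + (of_real (2^-1 ^+ n) * c) *: pair_diff m p).
rewrite opprD addrA subrr add0r rnormN -scalerA rnormZ rnorm_of_real.
rewrite ger0_norm ?exprn_ge0 ?invr_ge0// => h.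
suff : 2^-1 ^+ n * rnorm (c *: pair_diff m p) <= e / 2.
  by move: pL; rewrite -scalerA; lra.
apply: le_trans nD; rewrite ler_wpM2l ?exprn_ge0 ?invr_ge0//.
rewrite rnormZ (@le_trans _ _ (rnorm c * (2 * B)))//; last by rewrite lerDl.
by rewrite ler_wpM2l ?rnorm_ge0 ?pair_diff_le.
Qed.

Lemma iterated_type_coefs w w' (Y : X) (d : R) :
  map fst w = map fst w' -> 0 <= d ->
  (forall i, rnorm ((nth (0, 0) w i).2 - (nth (0, 0) w' i).2) <= d) ->
  iterated_type w Y <= iterated_type w' Y + (size w)%:R * (2 * B * d).
Proof.
move=> ww' d0; elim: w w' Y ww' => [|[m c] w IH] [|[m' c'] w']//= Y.
  by rewrite mul0r addr0.
case=> <-{m'} ww' wd; apply/ler_addgt0Pr => e e0.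
have e20 : 0 < e / 2 by rewrite divr_gt0.
have [p [/= p1 p2]] := filter_ex (filterI
  (iterated_type_cvg m c Y (iterated_type_lipschitz w) e20)
  (iterated_type_cvg m c' Y (iterated_type_lipschitz w') e20)).
have h1 := IH w' (Y + c *: pair_diff m p) ww' (fun i => wd i.+1).
have := iterated_type_lipschitz w' (Y + c *: pair_diff m p) (Y + c' *: pair_diff m p).
rewrite opprD addrACA subrr add0r -scalerBl rnormZ => h2.
have h3 : rnorm (c - c') * rnorm (pair_diff m p) <= 2 * B * d.
  rewrite mulrC ler_pM ?rnorm_ge0 ?pair_diff_le//; exact: (wd 0).
rewrite -natr1 mulrDl mul1r.
by move: p1 p2; rewrite !ltr_norml => /andP[? ?] /andP[? ?]; lra.
Qed.

End IteratedTypes.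

(** * Selection of a Schreier unconditional sequence *)

Lemma history_choice (T : Type) (Q : seq T -> set T) :
  (forall h, exists x, Q h x) -> exists x : nat -> T, forall n, Q (mkseq x n) (x n).
Proof.
move=> /choice[f fQ]; pose h := fix h n := if n is n'.+1 then rcons (h n') (f (h n')) else [::].
exists (fun n => f (h n)) => n.
suff -> : mkseq (fun n => f (h n)) n = h n by [].
by elim: n => [//|n IH]; rewrite mkseqS IH.
Qed.

Lemma sum_geometric_le (R : realType) (e : R) (T : nat) : 0 <= e ->
  \sum_(s < T) e * 2^-1 ^+ s.+1 <= e.
Proof.
move=> e0; suff -> : \sum_(s < T) e * 2^-1 ^+ s.+1 = e - e * 2^-1 ^+ T.
  by rewrite gerBl mulr_ge0// exprn_ge0// invr_ge0.
elim: T => [|T IH]; first by rewrite big_ord0 expr0 mulr1 subrr.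
by rewrite big_ord_recr /= IH exprS; field.
Qed.

Section Selection.
Context {R : realType} {cplx : bool}.
Local Notation K := (scalars R cplx).
Context {X : completeNormedModType K} (v : nat -> nat -> X) (B : R).
Hypothesis vB : forall m j, rnorm (v m j) <= B.

Section OneStage.
Context (U : set_system nat) {UU : UltraFilter U}.
Let W := pair_filter U.
Let WU : UltraFilter W := pair_filter_ultra UU.
#[local] Existing Instance WU.
Local Notation tau := (iterated_type v U).
Let B0 : 0 <= B. Proof. exact: le_trans (rnorm_ge0 _) (vB 0 0). Qed.

Definition row_word (n : nat) (w : seq (nat * K)) : Prop :=
  forall a, a \in w -> a.1 = n /\ rnorm a.2 <= 1.

(** Choosing p as the next pair nearly realizes the limit that defines the type,
    uniformly over all combinations of the vectors u already chosen and over all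
    short words w of vectors of row n still to come. *)
Definition type_step (m n L t : nat) (e : R) (u : nat -> X) (p : nat * nat) : Prop :=
  forall (c : nat -> K) (w : seq (nat * K)),
    (forall i, rnorm (c i) <= 1) -> row_word n w -> (size w <= L)%N ->
    `|tau w (\sum_(s < t) c s *: u s + c t *: pair_diff v m p)
      - tau ((m, c t) :: w) (\sum_(s < t) c s *: u s)| <= e.

(** Pointwise this is the definition of the limit; the combinations and words are
    parametrized by finitely many scalars of modulus at most one, hence uniformity. *)
Lemma type_step_ultra (m n L t : nat) (e : R) (u : nat -> X) : 0 < e ->
  (forall s, rnorm (u s) <= 2 * B) -> W (type_step m n L t e u).
Proof.
move=> e0 uB.
pose wd r (a : nat -> K) := [seq (n, a (t.+1 + i)%N) | i <- iota 0 r].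
pose Y (a : nat -> K) := \sum_(s < t) a s *: u s.
have YL (a b : nat -> K) d : (forall i, (i < t)%N -> rnorm (a i - b i) <= d) ->
    rnorm (Y a - Y b) <= t%:R * (2 * B * d).
  move=> abd; rewrite /Y -sumrB (le_trans (rnorm_sum _ _ _))//.
  have -> : t%:R * (2 * B * d) = \sum_(s < t) (2 * B * d).
    by rewrite sumr_const card_ord mulr_natl.
  apply: ler_sum => s _; rewrite -scalerBl rnormZ mulrC ler_pM ?rnorm_ge0//.
  exact: abd.
have NE r d : (t.+1 + r)%:R * (2 * B) * d
    = t%:R * (2 * B * d) + 2 * B * d + r%:R * (2 * B * d).
  by rewrite natrD -[t.+1%:R]natr1; ring.
have one_length r : W [set p | forall a : nat -> K,
    (forall i, (i < t.+1 + r)%N -> rnorm (a i) <= 1) ->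
    `|tau (wd r a) (Y a + a t *: pair_diff v m p) - tau ((m, a t) :: wd r a) (Y a)| <= e].
  have wdL (a b : nat -> K) (d : R) Z : 0 <= d ->
      (forall i, (i < t.+1 + r)%N -> rnorm (a i - b i) <= d) ->
      tau (wd r a) Z <= tau (wd r b) Z + r%:R * (2 * B * d).
    move=> d0 abd.
    have := @iterated_type_coefs _ _ _ _ _ vB U UU (wd r a) (wd r b) Z d _ d0.
    rewrite size_map size_iota; apply.
      by rewrite /wd -!map_comp; apply: eq_map.
    move=> i; have [ir|ri] := ltnP i r.
      by rewrite !(nth_map 0%N) ?size_iota// nth_iota//= add0n abd// ltn_add2l.
    by rewrite !nth_default ?size_map ?size_iota//= subrr rnorm0.
  apply: (@ultra_cvg_uniform _ _ _ W WU
    (fun p a => tau (wd r a) (Y a + a t *: pair_diff v m p))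
    (fun a => tau ((m, a t) :: wd r a) (Y a)) (t.+1 + r)%N ((t.+1 + r)%:R * (2 * B)))
    => //.
  - move=> p; suff H (a b : nat -> K) (d : R) :
        (forall i, (i < t.+1 + r)%N -> rnorm (a i - b i) <= d) -> 0 <= d ->
        tau (wd r a) (Y a + a t *: pair_diff v m p) <=
        tau (wd r b) (Y b + b t *: pair_diff v m p) + (t.+1 + r)%:R * (2 * B) * d.
      move=> a b d abd d0; rewrite ler_norml; apply/andP; split; last first.
        by rewrite lerBlDl H.
      rewrite lerNl opprB lerBlDl H// => i ir; rewrite rnorm_distC; exact: abd.
    move=> abd d0; apply: le_trans (wdL _ _ _ _ d0 abd) _.
    apply: le_trans (lerD (iterated_type_lipschitz vB _ _ (Y b + b t *: pair_diff v m p)) (lexx _)) _.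
    rewrite -[leLHS]addrA lerD2l opprD addrACA -scalerBl.
    apply: le_trans (lerD (rnormD _ _) (lexx _)) _.
    rewrite rnormZ NE lerD2r lerD//; first by rewrite YL// => i it; apply: abd; lia.
    rewrite mulrC ler_pM ?rnorm_ge0 ?(pair_diff_le vB)//; apply: abd; lia.
  - move=> a b d abd d0.
    suff H (a' b' : nat -> K) : 
        (forall i, (i < t.+1 + r)%N -> rnorm (a' i - b' i) <= d) ->
        tau ((m, a' t) :: wd r a') (Y a') <=
        tau ((m, b' t) :: wd r b') (Y b') + (t.+1 + r)%:R * (2 * B) * d.
      rewrite ler_norml; apply/andP; split; last first.
        by rewrite lerBlDl H.
      rewrite lerNl opprB lerBlDl H// => i ir; rewrite rnorm_distC; exact: abd.
    move=> abd'.
    apply: le_trans (iterated_type_lipschitz vB _ _ (Y b')) _.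
    apply: le_trans (lerD (iterated_type_coefs vB (w' := (m, b' t) :: wd r b') _ _ d0 _) (lexx _)) _.
    + by rewrite /= /wd -!map_comp; congr cons; apply: eq_map.
    + case=> [|i] /=; first by apply: abd'; lia.
      have [ir|ri] := ltnP i r.
        by rewrite !(nth_map 0%N) ?size_iota// nth_iota//= add0n abd'// ltn_add2l.
      by rewrite !nth_default ?size_map ?size_iota//= subrr rnorm0.
    rewrite NE -addrA lerD2l /= size_map size_iota -natr1 mulrDl mul1r.
    have : rnorm (Y a' - Y b') <= t%:R * (2 * B * d) by apply: YL => i it; apply: abd'; lia.
    lra.
  - move=> a e' e'0.
    apply: (@iterated_type_cvg _ _ _ v B vB U UU m (a t) (tau (wd r a)) (Y a) e' _ e'0).
    by move=> Y1 Y2; apply: (iterated_type_lipschitz vB).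
have : W [set p | forall r : 'I_L.+1, forall a : nat -> K,
    (forall i, (i < t.+1 + r)%N -> rnorm (a i) <= 1) ->
    `|tau (wd r a) (Y a + a t *: pair_diff v m p) - tau ((m, a t) :: wd r a) (Y a)| <= e] by
  exact: (@filter_forall _ _ _ W _ (fun r : 'I_L.+1 => one_length r)).
apply: (@filterS _ W) => p /= pL c w c1 wn wL.
pose a i := if (i <= t)%N then c i else (nth (n, 0) w (i - t.+1)).2.
have := pL (Ordinal (wL : (size w < L.+1)%N)) a.
have -> : wd (Ordinal (wL : (size w < L.+1)%N)) a = w.
  apply: (@eq_from_nth _ (n, 0)); first by rewrite size_map size_iota.
  move=> i; rewrite size_map size_iota /= => iw.
  rewrite (nth_map 0%N) ?size_iota// nth_iota// add0n /a leqNgt ltnS leq_addr /= addKn.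
  by rewrite [RHS]surjective_pairing; congr pair; case: (wn _ (mem_nth (n, 0) iw)).
have -> : Y a = \sum_(s < t) c s *: u s.
  by apply: eq_bigr => s _; rewrite /a ltnW.
have -> : a t = c t by rewrite /a leqnn.
apply=> i /= iN; rewrite /a; case: leqP => // ti.
have iw : (i - t.+1 < size w)%N by lia.
by case: (wn _ (mem_nth (n, 0) iw)).
Qed.

End OneStage.

Section Telescope.
Context (U : set_system nat) {UU : UltraFilter U}.
Local Notation tau := (iterated_type v U).
Context (row l : nat -> nat) (eps : nat -> R) (p : nat -> nat * nat).
Let u (t : nat) : X := pair_diff v (row t) (p t).
Hypothesis steps : forall n t, (n <= t)%N ->
  type_step U (row t) n (l n) t (eps t) u (p t).
Context (n : nat) (F : pred nat) (b : nat -> K).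
Hypothesis F_row : forall t, F t -> (n <= t)%N /\ row t = n.
Hypothesis b1 : forall t, rnorm (b t) <= 1.

Let word (t k : nat) : seq (nat * K) := [seq (n, b s) | s <- iota t k & F s].
Let full (t : nat) : X := \sum_(s < t) b s *: u s.
Let kept (s : nat) : K := if (s < n)%N || F s then b s else 0.
Let reduced (t : nat) : X := \sum_(s < t) kept s *: u s.

Let word_row t k : row_word n (word t k).
Proof. by move=> a /mapP[s _ ->]; split => //; exact: b1. Qed.

Let size_word t k : size (word t k) = count F (iota t k).
Proof. by rewrite size_map size_filter. Qed.

Let kept1 s : rnorm (kept s) <= 1.
Proof. by rewrite /kept; case: ifP; rewrite ?rnorm0. Qed.

(** Going from t + k down to t, a vector outside F is dropped by monotonicity of
    the types, and a vector of F is moved into the word. *)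
Let type_le_full k t : (n <= t)%N -> (count F (iota t k) <= l n)%N ->
  tau (word t k) (full t) <= rnorm (full (t + k)) + \sum_(t <= s < t + k) eps s.
Proof.
elim: k t => [|k IH] t nt cF; first by rewrite addn0 big_geq ?addr0.
have cF' : (count F (iota t.+1 k) <= l n)%N by apply: leq_trans cF; rewrite /= leq_addl.
have := IH t.+1 (leqW nt) cF'; rewrite addSnnS => IHt.
rewrite big_ltn; last by rewrite addnS ltnS leq_addr.
have fS : full t.+1 = full t + b t *: u t by rewrite /full big_ord_recr.
have := steps nt b1 (@word_row t.+1 k).
rewrite size_word => /(_ cF'); rewrite -/(full t) -fS ler_norml => /andP[st _].
have [Ft|nFt] := boolP (F t).
  have wE : word t k.+1 = (n, b t) :: word t.+1 k by rewrite /word /= Ft.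
  by move: st; rewrite wE (F_row Ft).2; lra.
have -> : word t k.+1 = word t.+1 k by rewrite /word /= (negbTE nFt).
have := @iterated_type_increasing _ _ _ v B vB U UU (word t.+1 k) (row t) (b t) (full t).
by lra.
Qed.

(** The same descent when the vectors outside F are absent: the two steps are
    now an equality and a passage into the word. *)
Let reduced_le_type k t : (n <= t)%N -> (count F (iota t k) <= l n)%N ->
  rnorm (reduced (t + k)) <= tau (word t k) (reduced t) + \sum_(t <= s < t + k) eps s.
Proof.
elim: k t => [|k IH] t nt cF; first by rewrite addn0 big_geq ?addr0.
have cF' : (count F (iota t.+1 k) <= l n)%N by apply: leq_trans cF; rewrite /= leq_addl.
have := IH t.+1 (leqW nt) cF'; rewrite addSnnS => IHt.
rewrite big_ltn; last by rewrite addnS ltnS leq_addr.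
have fS : reduced t.+1 = reduced t + kept t *: u t by rewrite /reduced big_ord_recr.
have := steps nt kept1 (@word_row t.+1 k).
rewrite size_word => /(_ cF'); rewrite -/(reduced t) -fS ler_norml => /andP[st st'].
have [Ft|nFt] := boolP (F t).
  have wE : word t k.+1 = (n, b t) :: word t.+1 k by rewrite /word /= Ft.
  have kE : kept t = b t by rewrite /kept Ft orbT.
  by move: st st'; rewrite wE kE (F_row Ft).2; lra.
have -> : word t k.+1 = word t.+1 k by rewrite /word /= (negbTE nFt).
have k0 : kept t = 0 by rewrite /kept (negbTE nFt) ltnNge nt.
rewrite k0 in st st'; rewrite fS k0 scale0r addr0 in IHt.
suff : 0 <= eps t by lra.
by rewrite -(ler_pMn2r (n := 2))// mul0rn; lra.
Qed.

(** Both descents end at the same type of the same initial vector. *)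
Lemma telescope T : (n <= T)%N -> (count F (iota 0 T) <= l n)%N ->
  rnorm (\sum_(s < T | (s < n)%N || F s) b s *: u s)
    <= rnorm (\sum_(s < T) b s *: u s) + 2 * \sum_(n <= s < T) eps s.
Proof.
move=> nT cF.
have cF' : (count F (iota n (T - n)) <= l n)%N.
  by apply: leq_trans cF; rewrite -{2}(subnKC nT) iotaD count_cat leq_addl.
have := type_le_full (leqnn n) cF'; have := reduced_le_type (leqnn n) cF'.
rewrite !subnKC//.
have -> : reduced n = full n by apply: eq_bigr => s _; rewrite /kept ltn_ord.
have -> : reduced T = \sum_(s < T | (s < n)%N || F s) b s *: u s.
  rewrite [RHS]big_mkcond; apply: eq_bigr => s _; rewrite /kept.
  by case: ifP => // _; rewrite scale0r.
by rewrite -/(full T); lra.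
Qed.

End Telescope.

(** Schreier unconditionality of a well chosen sequence of differences.  The
    terms with index below n are kept because only types of words in rows
    n <= t are under control at stage t; they are removed by a second use of the
    lemma with F empty. *)
Lemma selection (row l g : nat -> nat) (e : R) : 0 < e ->
  exists kappa : nat -> nat,
  let u t := v (row t) (kappa t.*2) - v (row t) (kappa t.*2.+1) in
  [/\ {homo kappa : i j / (i < j)%N},
    forall t, (g t <= kappa t.*2)%N &
    forall (n T : nat) (F : pred nat) (b : nat -> K),
      (forall t, F t -> (n <= t)%N /\ row t = n) ->
      (forall t, rnorm (b t) <= 1) ->
      (n <= T)%N -> (count F (iota 0 T) <= l n)%N ->
      rnorm (\sum_(s < T | (s < n)%N || F s) b s *: u s)
        <= rnorm (\sum_(s < T) b s *: u s) + e].
Proof.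
move=> e0; have [U [UU Ufree]] := free_ultrafilter_nat.
have WU := pair_filter_ultra UU.
have WF : Filter (pair_filter U) by exact: _.
pose eps t := e / 2 * 2^-1 ^+ t.+1.
have eps0 t : 0 < eps t by rewrite mulr_gt0 ?divr_gt0// exprn_gt0 ?invr_gt0.
pose vec (h : seq (nat * nat)) s := pair_diff v (row s) (nth (0, 0)%N h s).
pose Q (h : seq (nat * nat)) : set (nat * nat) :=
  [set q | [/\ forall n : 'I_(size h).+1,
      type_step U (row (size h)) n (l n) (size h) (eps (size h)) (vec h) q,
    (\max_(q' <- h) q'.2 < q.1)%N, (g (size h) < q.1)%N & (q.1 < q.2)%N]].
have [p pQ] : exists p : nat -> nat * nat, forall n, Q (mkseq p n) (p n).
  apply: history_choice => h; apply: (@filter_ex _ (pair_filter U)).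
  have W1 : pair_filter U [set q | forall n : 'I_(size h).+1,
      type_step U (row (size h)) n (l n) (size h) (eps (size h)) (vec h) q].
    have W0 (n : 'I_(size h).+1) : pair_filter U
        (type_step U (row (size h)) n (l n) (size h) (eps (size h)) (vec h)).
      by apply: type_step_ultra => // s; exact: pair_diff_le.
    exact: (@filter_forall _ _ _ (pair_filter U) _ W0).
  have W2 (N : nat) : pair_filter U [set q | (N < q.1)%N].
    by apply: (@filterS _ U) (Ufree N) => j Nj; exact: (@filterE _ U).
  have W3 : pair_filter U [set q | (q.1 < q.2)%N].
    by apply: (@filterE _ U) => j; exact: Ufree.
  pose WI := @filterI _ (pair_filter U) WF.
  have W4 := WI _ _ (WI _ _ W1 W3) (WI _ _ (W2 (\max_(q' <- h) q'.2)%N) (W2 (g (size h)))).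
  by apply: (@filterS _ (pair_filter U) WF _ _ _ W4) => q [[? ?] [? ?]].
pose kappa i := if odd i then (p i./2).2 else (p i./2).1.
have kE t : kappa t.*2 = (p t).1 by rewrite /kappa odd_double doubleK.
have kO t : kappa t.*2.+1 = (p t).2.
  by rewrite /kappa /= odd_double /= uphalf_double.
exists kappa => u; split.
- have kS i : (kappa i < kappa i.+1)%N.
    rewrite -(odd_double_half i); case: (odd i) => /=; last first.
      by rewrite add0n kE kO; case: (pQ i./2).
    rewrite add1n kO -doubleS kE; have [_ + _ _] := pQ i./2.+1.
    apply: leq_ltn_trans; rewrite mkseqS -cats1 big_cat big_seq1 /=.
    by rewrite leq_maxr.
  by move=> i j ij; apply: (homo_ltn ltn_trans kS).
- by move=> t; rewrite kE; have [_ _ + _] := pQ t; rewrite size_mkseq => /ltnW.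
- move=> n T F b FP b1 nT cF.
  have uE t : u t = pair_diff v (row t) (p t) by rewrite /u kE kO.
  have steps n' t : (n' <= t)%N ->
      type_step U (row t) n' (l n') t (eps t) (fun t => pair_diff v (row t) (p t)) (p t).
    move=> n't; have [+ _ _ _] := pQ t; rewrite size_mkseq.
    move=> /(_ (Ordinal (n't : (n' < t.+1)%N))) /= H c w c1 wr ws.
    have := H c w c1 wr ws.
    have -> // : \sum_(s < t) c s *: vec (mkseq p t) s =
      \sum_(s < t) c s *: pair_diff v (row s) (p s).
    by apply: eq_bigr => s _; rewrite /vec nth_mkseq.
  have sumE (A : pred nat) : \sum_(s < T | A s) b s *: u s
      = \sum_(s < T | A s) b s *: pair_diff v (row s) (p s).
    by apply: eq_bigr => s _; rewrite uE.
  rewrite (sumE (fun s => (s < n)%N || F s)) (sumE xpredT).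
  apply: le_trans (telescope steps FP b1 nT cF) _; rewrite lerD2l.
  have -> : e = 2 * (e / 2) by field.
  rewrite ler_pM2l//; apply: le_trans (sum_geometric_le T (ltW (divr_gt0 e0 _)))=> //.
  rewrite -(big_mkord xpredT (fun s => e / 2 * 2^-1 ^+ s.+1)) (big_cat_nat (leq0n n) nT) /=.
  by rewrite lerDr sumr_ge0 // => s _; exact: ltW (eps0 s).
Qed.

End Selection.

(** * Expansions and the criterion of Grunblum *)

Lemma natSinv_lt (R : realType) (e : R) : 0 < e -> exists N, N.+1%:R^-1 < e.
Proof.
move=> e0; exists (Num.truncn e^-1).
by rewrite -[ltRHS]invrK ltf_pV2 ?posrE ?invr_gt0// truncnS_gt.
Qed.

Section Bases.
Context {R : realType} {cplx : bool}.
Local Notation K := (scalars R cplx).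
Context {X : completeNormedModType K}.
Implicit Types (x : nat -> X) (a : nat -> K) (y : X).

Definition partial_sum x a n : X := \sum_(i < n) a i *: x i.

(** Kept separate from [schauder_basis], because expansions are manipulated
    before any uniqueness is known. *)
Definition expands x a y := series (fun i => a i *: x i) @ \oo --> y.

Lemma expandsP x a y : expands x a y <->
  forall e : R, 0 < e -> exists N, forall n, (N <= n)%N ->
    rnorm (partial_sum x a n - y) < e.
Proof.
rewrite /expands; split=> [/cvg_rnormP H e e0|H].
  have [N _ NH] := H e e0; exists N => n Nn.
  by have := NH n Nn; rewrite /= seriesEord.
apply/cvg_rnormP => e e0; have [N NH] := H e e0.
by exists N => // n Nn /=; rewrite seriesEord; exact: NH.
Qed.

Lemma partial_sumD x a a' n :
  partial_sum x (fun i => a i + a' i) n = partial_sum x a n + partial_sum x a' n.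
Proof. by rewrite -big_split; apply: eq_bigr => i _; rewrite scalerDl. Qed.

Lemma partial_sumB x a a' n :
  partial_sum x (fun i => a i - a' i) n = partial_sum x a n - partial_sum x a' n.
Proof. by rewrite -sumrB; apply: eq_bigr => i _; rewrite scalerBl. Qed.

Lemma partial_sumZ x (c : K) a n :
  partial_sum x (fun i => c * a i) n = c *: partial_sum x a n.
Proof. by rewrite scaler_sumr; apply: eq_bigr => i _; rewrite scalerA. Qed.

Lemma partial_sumS x a n : partial_sum x a n.+1 = partial_sum x a n + a n *: x n.
Proof. by rewrite /partial_sum big_ord_recr. Qed.

Lemma partial_sum_truncate x a n m : (n <= m)%N ->
  partial_sum x (fun i => if (i < n)%N then a i else 0) m = partial_sum x a n.
Proof.
move=> nm; rewrite /partial_sum -(subnKC nm) big_split_ord /=.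
rewrite [X in _ + X]big1 ?addr0; last first.
  by move=> i _; rewrite ltnNge leq_addr /= scale0r.
by apply: eq_bigr => i _; rewrite ltn_ord.
Qed.

Lemma expands_truncate x a n :
  expands x (fun i => if (i < n)%N then a i else 0) (partial_sum x a n).
Proof.
apply/expandsP => e e0; exists n => m nm.
by rewrite partial_sum_truncate// subrr rnorm0.
Qed.

Lemma expandsD x a a' y y' : expands x a y -> expands x a' y' ->
  expands x (fun i => a i + a' i) (y + y').
Proof.
move=> /expandsP ay /expandsP ay'; apply/expandsP => e e0.
have e20 : 0 < e / 2 by rewrite divr_gt0.
have [N HN] := ay _ e20; have [N' HN'] := ay' _ e20.
exists (maxn N N') => n; rewrite geq_max => /andP[Nn N'n].
rewrite partial_sumD opprD addrACA (le_lt_trans (rnormD _ _))//.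
by have := HN _ Nn; have := HN' _ N'n; lra.
Qed.

Lemma expandsZ x (c : K) a y : expands x a y -> expands x (fun i => c * a i) (c *: y).
Proof.
move=> /expandsP ay; apply/expandsP => e e0.
have c1 : 0 < rnorm c + 1 by rewrite ltr_wpDl// rnorm_ge0.
have [N HN] := ay _ (divr_gt0 e0 c1).
exists N => n Nn; rewrite partial_sumZ -scalerBr rnormZ.
have := HN _ Nn; rewrite ltr_pdivlMr// => h; apply: le_lt_trans h.
by rewrite mulrDr mulr1 mulrC lerDl rnorm_ge0.
Qed.

Lemma closed_spanP x y : closed_span x y <->
  forall e : R, 0 < e -> exists n a, rnorm (y - partial_sum x a n) < e.
Proof.
rewrite /closed_span; split=> [/closure_rnormP H e e0|H].
  have [_ [n [a ->]] ya] := H e e0.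
  exists n, (fun i => if insub i is Some j then a j else 0).
  rewrite /partial_sum (eq_bigr (fun i : 'I_n => a i *: x i))// => i _.
  by rewrite insubT// => h; congr (a _ *: _); exact: val_inj.
apply/closure_rnormP => e e0; have [n [a ya]] := H e e0.
by exists (partial_sum x a n) => //; exists n, (fun i : 'I_n => a i).
Qed.

Lemma closed_span_partial_sum x a n : closed_span x (partial_sum x a n).
Proof. by apply/closed_spanP => e e0; exists n, a; rewrite subrr rnorm0. Qed.

Lemma partial_sum_delta x i :
  partial_sum x (fun j => (j == i)%:R) i.+1 = x i.
Proof.
rewrite partial_sumS eqxx scale1r [partial_sum _ _ _]big1 ?add0r// => j _.
by rewrite ltn_eqF ?ltn_ord// scale0r.
Qed.

Lemma closed_span_gen x i : closed_span x (x i).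
Proof. rewrite -(partial_sum_delta x i); exact: closed_span_partial_sum. Qed.

Lemma closed_subspace_span x : closed_subspace (closed_span x).
Proof.
split; last exact: closed_closure.
split.
  have -> : 0 = partial_sum x (fun=> 0) 0 by rewrite /partial_sum big_ord0.
  exact: closed_span_partial_sum.
move=> c u w /closed_spanP Hu /closed_spanP Hw; apply/closed_spanP => e e0.
have c1 : 0 < rnorm c + 1 by rewrite ltr_wpDl// rnorm_ge0.
have e20 : 0 < e / 2 by rewrite divr_gt0.
have [n [a ua]] := Hu _ (divr_gt0 e20 c1); have [m [b wb]] := Hw _ e20.
exists (maxn n m), (fun i => c * (if (i < n)%N then a i else 0) + (if (i < m)%N then b i else 0)).
rewrite partial_sumD partial_sumZ !partial_sum_truncate ?leq_maxl ?leq_maxr//.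
rewrite opprD addrACA -scalerBr (le_lt_trans (rnormD _ _))// rnormZ.
move: ua; rewrite ltr_pdivlMr// => ua.
have : rnorm c * rnorm (u - partial_sum x a n) <=
    rnorm (u - partial_sum x a n) * (rnorm c + 1).
  by rewrite mulrDr mulr1 mulrC lerDl rnorm_ge0.
lra.
Qed.

Lemma expands_closed_span x a y : expands x a y -> closed_span x y.
Proof.
move=> /expandsP H; apply/closed_spanP => e e0; have [N HN] := H e e0.
by exists N, a; rewrite rnorm_distC HN.
Qed.

(** Coefficientwise ultralimits of expansions whose partial sums are uniformly
    Cauchy give an expansion of the limit; compactness of bounded sets of
    scalars replaces completeness of the scalar field. *)
Lemma expands_limit x (s : nat -> nat -> K) (Y : nat -> X) (y : X) :
  (forall i, x i != 0) -> (forall k, expands x (s k) (Y k)) ->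
  (forall e : R, 0 < e -> exists N, forall k, (N <= k)%N -> rnorm (Y k - y) <= e) ->
  (forall e : R, 0 < e -> exists N, forall k m, (N <= k)%N ->
     rnorm (partial_sum x (s k) m - partial_sum x (s N) m) <= e) ->
  exists a, expands x a y /\ forall e : R, 0 < e -> exists N, forall k m, (N <= k)%N ->
     rnorm (partial_sum x a m - partial_sum x (s k) m) <= e.
Proof.
move=> x0 sY Yy sC.
have xgt0 i : 0 < rnorm (x i) by rewrite rnorm_gt0.
have [N1 N1P] := sC 1 ltr01.
have bnd i k : rnorm (s (N1 + k)%N i) <= rnorm (s N1 i) + 2 / rnorm (x i).
  have h1 := N1P _ i (leq_addr k N1); have h2 := N1P _ i.+1 (leq_addr k N1).
  have : rnorm (s (N1 + k)%N i - s N1 i) <= 2 / rnorm (x i).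
    rewrite ler_pdivlMr// -rnormZ scalerBl.
    have -> : s (N1 + k)%N i *: x i - s N1 i *: x i =
      (partial_sum x (s (N1 + k)%N) i.+1 - partial_sum x (s N1) i.+1) -
      (partial_sum x (s (N1 + k)%N) i - partial_sum x (s N1) i).
      by rewrite !partial_sumS [in RHS](opprD (partial_sum x (s N1) i)) addrACA [RHS]addrAC subrr add0r.
    by rewrite (le_trans (rnormB _ _))//; lra.
  by have := rnormBl (s (N1 + k)%N i) (s N1 i); lra.
have [U [UU Ufree]] := free_ultrafilter_nat.
have lims i : exists l : K, forall e : R, 0 < e ->
    U [set k | rnorm (s (N1 + k)%N i - l) < e].
  exact: (ultra_cvg_scalars (bnd i)).
have [a aP] := choice lims.
have sums m (e : R) : 0 < e -> U [set k | rnorm (partial_sum x (s (N1 + k)%N) m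
    - partial_sum x a m) < e].
  elim: m e => [|m IH] e e0.
    apply: (@filterE _ U) => k /=.
    by rewrite /partial_sum !big_ord0 subrr rnorm0.
  have e20 : 0 < e / 2 by rewrite divr_gt0.
  apply: (filterS _ (@filterI _ U _ _ _ (IH _ e20) (aP m _ (divr_gt0 e20 (xgt0 m))))).
  move=> k [/= h1]; rewrite ltr_pdivlMr// -rnormZ scalerBl => h2.
  by rewrite !partial_sumS opprD addrACA (le_lt_trans (rnormD _ _))//; lra.
have close (e : R) : 0 < e -> exists N, forall k m, (N <= k)%N ->
     rnorm (partial_sum x a m - partial_sum x (s k) m) <= e.
  move=> e0; have e30 : 0 < e / 3 by rewrite divr_gt0.
  have [N NP] := sC _ e30; exists N => k m Nk.
  have [j [/= jk jm]] := @filter_ex _ U _ _ (@filterI _ U _ _ _ (Ufree k) (sums m _ e30)).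
  have h1 := NP (N1 + j)%N m (leq_trans Nk (leq_trans (ltnW jk) (leq_addl _ _))).
  have h2 := NP k m Nk.
  have h3 := rnorm_triangle (partial_sum x a m) (partial_sum x (s (N1 + j)%N) m) (partial_sum x (s k) m).
  have h4 := rnorm_triangle (partial_sum x (s (N1 + j)%N) m) (partial_sum x (s N) m) (partial_sum x (s k) m).
  rewrite rnorm_distC in jm; rewrite (rnorm_distC (partial_sum x (s k) m)) in h2.
  lra.
exists a; split => //; apply/expandsP => e e0.
have e40 : 0 < e / 4 by rewrite divr_gt0.
have [N NP] := close _ e40; have [M MP] := Yy _ e40.
have [k kN kM] : exists2 k, (N <= k)%N & (M <= k)%N.
  by exists (maxn N M); rewrite ?leq_maxl ?leq_maxr.
have /expandsP /(_ _ e40)[L LP] := sY k.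
exists L => n Ln.
have h1 := NP k n kN; have h2 := MP k kM; have h3 := LP n Ln.
have h4 := rnorm_triangle (partial_sum x a n) (partial_sum x (s k) n) y.
have h5 := rnorm_triangle (partial_sum x (s k) n) (Y k) y.
lra.
Qed.

(** Grunblum's criterion.  Approximants in the linear span have uniformly Cauchy
    partial sums, which gives existence; the constant applied to an expansion of
    0 gives uniqueness. *)
Lemma schauder_basis_of_constant x (C : R) : (forall i, x i != 0) ->
  (forall a m n, (m <= n)%N ->
    rnorm (partial_sum x a m) <= C * rnorm (partial_sum x a n)) ->
  schauder_basis (closed_span x) x.
Proof.
move=> x0 xC; split; first exact: closed_span_gen.
have C0 : 0 <= C.
  have h : rnorm (x 0%N) <= C * rnorm (x 0%N).
    by have := xC (fun=> 1) 1%N 1%N (leqnn _); rewrite /partial_sum big_ord1 scale1r.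
  have xgt : 0 < rnorm (x 0%N) by rewrite rnorm_gt0.
  by rewrite -(pmulr_lge0 _ xgt); exact: le_trans (ltW xgt) h.
have inv_gt0 k : 0 < k.+1%:R^-1 :> R by rewrite invr_gt0.
move=> y Yy.
have ex_a : exists a, expands x a y.
  have /choice[nk /choice[ak akP]] : forall k, exists n, exists a,
      rnorm (y - partial_sum x a n) < k.+1%:R^-1.
    by move=> k; move/closed_spanP : Yy; apply.
  pose s k i := if (i < nk k)%N then ak k i else 0.
  have [//|k|e e0|e e0|a [ay _]] := @expands_limit x s
    (fun k => partial_sum x (ak k) (nk k)) y; last by exists a.
  - exact: expands_truncate.
  - have [N Ne] := natSinv_lt e0.
    exists N => k Nk; rewrite rnorm_distC (le_trans (ltW (akP k)))// ltW// (le_lt_trans _ Ne)//.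
    by rewrite lef_pV2 ?posrE// ler_nat.
  - have eC : 0 < e / (2 * (C + 1)) by rewrite divr_gt0// mulr_gt0// ltr_wpDl.
    have [N Ne] := natSinv_lt eC.
    exists N => k m Nk; rewrite -partial_sumB.
    pose M := maxn m (maxn (nk k) (nk N)).
    apply: le_trans (xC _ _ M (leq_maxl _ _)) _.
    rewrite partial_sumB !partial_sum_truncate; [|by rewrite /M; lia|by rewrite /M; lia].
    have h1 := akP k; have h2 := akP N.
    have h3 : k.+1%:R^-1 <= N.+1%:R^-1 :> R by rewrite lef_pV2 ?posrE// ler_nat.
    have h4 := rnorm_triangle (partial_sum x (ak k) (nk k)) y (partial_sum x (ak N) (nk N)).
    rewrite (rnorm_distC _ y) in h4.
    rewrite ltr_pdivlMr ?mulr_gt0 ?ltr_wpDl// in Ne.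
    have := inv_gt0 N; move: Ne h1 h2 h3 => + + + +.
    move: (k.+1%:R^-1) (N.+1%:R^-1) => w' w Ne h1 h2 h3 w0.
    apply: le_trans (ler_wpM2l C0 (_ : _ <= 2 * w)) _; first by lra.
    by lra.
have [a ay] := ex_a; exists a; split => // b bY.
apply: funext => i; apply/eqP; rewrite -subr_eq0.
have d0 : expands x (fun i => a i - b i) 0.
  have := expandsD ay (expandsZ (c := -1) (bY : expands x b y)).
  rewrite scaleN1r subrr; congr expands; apply: funext => j.
  by rewrite mulN1r.
have ps0 m : partial_sum x (fun i => a i - b i) m = 0.
  apply/eqP; rewrite -rnorm_eq0 eq_le rnorm_ge0 andbT; apply/ler_addgt0Pr => e e0.
  rewrite add0r; have C1 : 0 < C + 1 by rewrite ltr_wpDl.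
  have /expandsP /(_ _ (divr_gt0 e0 C1)) [N NP] := d0.
  have := NP (maxn m N) (leq_maxr _ _); rewrite subr0 ltr_pdivlMr// => h.
  apply: le_trans (xC _ _ _ (leq_maxl m N)) _; apply: le_trans (ltW h).
  by rewrite mulrDr mulr1 mulrC lerDl rnorm_ge0.
have := partial_sumS x (fun i => a i - b i) i.
by rewrite !ps0 add0r => /esym /eqP; rewrite scaler_eq0 (negbTE (x0 i)) orbF.
Qed.

End Bases.

(** * The basis constant of a basic sequence *)

Section BasisConstant.
Context {R : realType} {cplx : bool}.
Local Notation K := (scalars R cplx).
Context {X : completeNormedModType K}.

(** Baire's theorem relative to a closed subset Y of X, which carries no structure
    of complete normed space of its own: nested balls with centres in Y. *)
Lemma baire_closed (Y : set X) (A : nat -> set X) (y0 : X) :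
  closed Y -> Y y0 -> (forall y, Y y -> exists n, A n y) ->
  exists n c (r : R), [/\ Y c, 0 < r & forall y, Y y -> rnorm (y - c) < r ->
    closure (A n) y].
Proof.
move=> clY Yy0 cover; apply: contrapT => noball.
have step n (s : X * R) : exists s' : X * R, Y s.1 -> 0 < s.2 ->
    [/\ Y s'.1, 0 < s'.2, s'.2 <= s.2 / 2, rnorm (s'.1 - s.1) <= s.2 / 2 &
        forall a, A n a -> s'.2 < rnorm (s'.1 - a)].
  have [[Ys s0]|h] := pselect (Y s.1 /\ 0 < s.2); last first.
    by exists s => ? ?; case: h.
  have s20 : 0 < s.2 / 2 by rewrite divr_gt0.
  have [y [Yy ys nAy]] : exists y, [/\ Y y, rnorm (y - s.1) < s.2 / 2 & ~ closure (A n) y].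
    apply: contrapT => h; apply: noball; exists n, s.1, (s.2 / 2); split => // y Yy ys.
    by apply: contrapT => nAy; apply: h; exists y.
  have [r [r0 rA]] : exists r : R, 0 < r /\ forall a, A n a -> r <= rnorm (y - a).
    apply: contrapT => h; apply: nAy; apply/closure_rnormP => e e0.
    apply: contrapT => h'; apply: h; exists e; split => // a Aa.
    by rewrite leNgt; apply/negP => ya; apply: h'; exists a.
  exists (y, Num.min (s.2 / 2) (r / 2)) => _ _ /=.
  have r20 : 0 < r / 2 by rewrite divr_gt0.
  split => //; rewrite ?lt_min ?s20 ?r20//; first by rewrite ge_min lexx.
    exact: ltW.
  move=> a Aa; rewrite gt_min; apply/orP; right.
  by have := rA _ Aa; lra.
have [f fP] := choice (fun ns : nat * (X * R) => step ns.1 ns.2).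
pose z := fix z n := if n is n'.+1 then f (n', z n') else (y0, 1).
have zP n : Y (z n).1 /\ 0 < (z n).2.
  by elim: n => [|n [Yz z0]]/=; [split|have [] := fP (n, z n) Yz z0].
have zS n : [/\ (z n.+1).2 <= (z n).2 / 2, rnorm ((z n.+1).1 - (z n).1) <= (z n).2 / 2 &
    forall a, A n a -> (z n.+1).2 < rnorm ((z n.+1).1 - a)].
  by have [Yz z0] := zP n; have [] := fP (n, z n) Yz z0.
have nested n k : rnorm ((z (n + k)%N).1 - (z n).1) <= (z n).2 - (z (n + k)%N).2.
  elim: k => [|k IH]; first by rewrite addn0 !subrr rnorm0.
  have [h1 h2 _] := zS (n + k)%N; rewrite addnS.
  have := rnorm_triangle (z (n + k).+1).1 (z (n + k)%N).1 (z n).1; lra.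
have rad n : (z n).2 <= 2^-1 ^+ n.
  elim: n => [|n IH]; first by rewrite expr0.
  by have [h1 _ _] := zS n; rewrite exprS; lra.
have [y zy] : exists y : X, (fun n => (z n).1) @ \oo --> y.
  apply: cauchy_rnorm_cvg => e e0.
  have e20 : 0 < e / 2 by rewrite divr_gt0.
  have [N Ne] := half_pow_lt e20.
  exists N => m n Nm Nn.
  have h1 := nested N (m - N)%N; have h2 := nested N (n - N)%N.
  rewrite !subnKC// in h1 h2.
  have := rnorm_triangle (z m).1 (z N).1 (z n).1; rewrite (rnorm_distC (z N).1).
  by have := rad N; have := (zP m).2; have := (zP n).2; lra.
have /cvg_rnormP zy' := zy.
have Yy : Y y.
  move/closure_id : (clY) => ->; apply/closure_rnormP => e e0.
  have [n _ /(_ n (leqnn n)) /= zn] := zy' e e0.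
  by exists (z n).1; [exact: (zP n).1|rewrite rnorm_distC].
have [n Any] := cover _ Yy.
suff : rnorm ((z n.+1).1 - y) <= (z n.+1).2.
  by have [_ _ /(_ _ Any)] := zS n; rewrite ltNge => /negP.
apply/ler_addgt0Pr => e e0; have [M _ /(_ _ (leq_maxl M n.+1)) /= My] := zy' _ e0.
have := nested n.+1 (maxn M n.+1 - n.+1)%N; rewrite subnKC ?leq_maxr// => h.
have := rnorm_triangle (z n.+1).1 (z (maxn M n.+1)).1 y.
rewrite (rnorm_distC (z n.+1).1 (z (maxn M n.+1)).1).
by have := (zP (maxn M n.+1)).2; lra.
Qed.

Implicit Types (x : nat -> X) (a : nat -> K) (y : X).

(** The sublevel sets of the norm sup_m || P_m y ||, with P_m the basis
    projections. *)
Definition expansion_bounded x (M : R) y :=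
  exists2 a, expands x a y & forall m, rnorm (partial_sum x a m) <= M.

Lemma expansion_boundedB x (M M' : R) y y' :
  expansion_bounded x M y -> expansion_bounded x M' y' ->
  expansion_bounded x (M + M') (y - y').
Proof.
move=> [a ay aM] [b bY bM]; exists (fun i => a i + (-1) * b i).
  have := expandsD ay (expandsZ (c := -1) bY); by rewrite scaleN1r.
move=> m; rewrite partial_sumD partial_sumZ scaleN1r.
by rewrite (le_trans (rnormB _ _))// lerD.
Qed.

Lemma expansion_boundedZ x (M : R) (c : K) y :
  expansion_bounded x M y -> expansion_bounded x (rnorm c * M) (c *: y).
Proof.
move=> [a ay aM]; exists (fun i => c * a i); first exact: expandsZ.
by move=> m; rewrite partial_sumZ rnormZ ler_wpM2l ?rnorm_ge0.
Qed.

Lemma expands_bounded x a y : expands x a y ->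
  exists n : nat, forall m, rnorm (partial_sum x a m) <= n%:R.
Proof.
move=> /expandsP /(_ 1 ltr01)[N NP].
pose M := rnorm y + 1 + \sum_(m < N) rnorm (partial_sum x a m).
exists (Num.truncn M).+1 => m; apply: le_trans (ltW (truncnS_gt M)).
rewrite /M; have [mN|Nm] := ltnP m N.
  rewrite (bigD1 (Ordinal mN))//= addrCA lerDl addr_ge0//.
    by rewrite addr_ge0 ?rnorm_ge0.
  by apply: sumr_ge0 => i _; exact: rnorm_ge0.
have := NP m Nm; have := rnormBl (partial_sum x a m) y.
have : 0 <= \sum_(m < N) rnorm (partial_sum x a m).
  by apply: sumr_ge0 => i _; exact: rnorm_ge0.
lra.
Qed.

(** Banach's theorem.  By Baire, vectors whose partial sums are bounded by N are
    dense in some ball, hence, by differences, near 0.  A vector of a small ball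
    is then a series of vectors with geometrically decreasing bounds, and
    [expands_limit] bounds the partial sums of its sum. *)
Lemma basis_constant x : basic_sequence x -> (forall i, x i != 0) ->
  exists C : R, 0 < C /\ forall a m n, (m <= n)%N ->
    rnorm (partial_sum x a m) <= C * rnorm (partial_sum x a n).
Proof.
move=> [_ xbasic] x0; set Y := closed_span x.
have [[Y0 Ylin] Yclosed] : closed_subspace Y := closed_subspace_span x.
have YB u w : Y u -> Y w -> Y (u - w).
  by move=> Yu Yw; rewrite addrC -scaleN1r; exact: Ylin.
have YZ c u : Y u -> Y (c *: u) by move=> Yu; rewrite -[_ *: _]addr0; exact: Ylin.
have uniq a b y : expands x a y -> expands x b y -> a = b.
  move=> ay bY; have [c [_ cU]] := xbasic y (expands_closed_span ay).
  by rewrite -(cU _ ay) -(cU _ bY).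
have cover y : Y y -> exists n : nat, expansion_bounded x n%:R y.
  move=> /xbasic[a [ay _]]; have [n nP] := expands_bounded ay.
  by exists n, a.
have [N [c [r [Yc r0 dense]]]] := baire_closed Yclosed Y0 cover.
pose M : R := 2 * N%:R.
(* The difference of two vectors of the ball around c is approximated by
   vectors with partial sums bounded by 2 N; rescale. *)
have approx y t (e : R) : 0 < t -> 0 < e -> Y y -> rnorm y < t * r ->
    exists w, expansion_bounded x (t * M) w /\ rnorm (y - w) < e.
  move=> t0 e0 Yy yr.
  have te : 0 < e / t / 2 by rewrite !divr_gt0.
  have Yy' : Y (of_real t^-1 *: y + c) by apply: Ylin.
  have near1 : closure [set y | expansion_bounded x N%:R y] (of_real t^-1 *: y + c).
    apply: dense => //; rewrite addrK rnormZ rnorm_of_real gtr0_norm ?invr_gt0//.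
    by rewrite ltr_pdivrMl.
  have near2 : closure [set y | expansion_bounded x N%:R y] c.
    by apply: dense => //; rewrite subrr rnorm0.
  have [w1 w1N h1] := (closure_rnormP _ _).1 near1 _ te.
  have [w2 w2N h2] := (closure_rnormP _ _).1 near2 _ te.
  exists (of_real t *: (w1 - w2)); split.
    have := expansion_boundedZ (of_real t) (expansion_boundedB w1N w2N).
    by rewrite rnorm_of_real gtr0_norm// /M mulr2n mulrDl mul1r.
  have -> : y - of_real t *: (w1 - w2) =
      of_real t *: ((of_real t^-1 *: y + c - w1) - (c - w2)).
    rewrite opprB [_ + c - w1]addrAC addrACA subrr addr0 -[in RHS]addrA [RHS]scalerDr scalerA.
    rewrite -of_realM divff ?gt_eqF// of_real1 scale1r; congr (_ + _).
    by rewrite -scalerN opprB addrC.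
  rewrite rnormZ rnorm_of_real gtr0_norm// -ltr_pdivlMl//.
  apply: le_lt_trans (rnormB _ _) _; rewrite mulrC; lra.
have ball_bounded y : Y y -> rnorm y < r -> expansion_bounded x (2 * M + 1) y.
  move=> Yy yr.
  have half_gt0 n : 0 < 2^-1 ^+ n :> R by rewrite exprn_gt0// invr_gt0.
  have step n (s : X) : exists w, Y s -> rnorm s < 2^-1 ^+ n * r ->
      expansion_bounded x (2^-1 ^+ n * M) w /\ rnorm (s - w) < 2^-1 ^+ n.+1 * r.
    have [[Ys sr]|h] := pselect (Y s /\ rnorm s < 2^-1 ^+ n * r); last first.
      by exists s => ? ?; case: h.
    have [w wP] := approx s _ _ (half_gt0 n) (mulr_gt0 (half_gt0 n.+1) r0) Ys sr.
    by exists w.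
  have [f fP] := choice (fun ns : nat * X => step ns.1 ns.2).
  pose z := fix z n := if n is n'.+1 then z n' - f (n', z n') else y.
  have zP n : Y (z n) /\ rnorm (z n) < 2^-1 ^+ n * r.
    elim: n => [|n [Yz zr]] /=; first by rewrite expr0 mul1r.
    have [[a aw _] fr] := fP (n, z n) Yz zr; split => //.
    by apply: YB => //; exact: expands_closed_span aw.
  have fB n : expansion_bounded x (2^-1 ^+ n * M) (f (n, z n)).
    by have [Yz zr] := zP n; have [] := fP (n, z n) Yz zr.
  have /choice[al alP] : forall n, exists a, expands x a (f (n, z n)) /\
      forall m, rnorm (partial_sum x a m) <= 2^-1 ^+ n * M.
    by move=> n; have [a ? ?] := fB n; exists a.
  pose s := fix s n : nat -> K := if n is n'.+1 then fun i => s n' i + al n' i else fun=> 0.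
  have M0 : 0 <= M by rewrite mulr_ge0.
  have sY n : expands x (s n) (y - z n).
    elim: n => [|n IH] /=.
      rewrite subrr; apply/expandsP => e e0; exists 0%N => m _.
      by rewrite /partial_sum big1 ?subr0 ?rnorm0// => i _; rewrite scale0r.
    by rewrite opprB addrCA addrC; apply: expandsD => //; case: (alP n).
  have sC n k m : rnorm (partial_sum x (s (n + k)%N) m - partial_sum x (s n) m)
      <= 2 * M * (2^-1 ^+ n - 2^-1 ^+ (n + k)).
    elim: k => [|k IH]; first by rewrite addn0 !subrr rnorm0 mulr0.
    rewrite addnS /= partial_sumD addrAC (le_trans (rnormD _ _))//.
    have := (alP (n + k)%N).2 m; rewrite exprS.
    by move: (2^-1 ^+ (n + k)) IH => q IH; lra.
  have [//||e e0|e e0|a [ay aC]] := @expands_limit _ _ _ x s (fun n => y - z n) y.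
  - exact: sY.
  - have [n ne] := half_pow_lt (divr_gt0 e0 r0).
    exists n => k nk; rewrite addrAC subrr add0r rnormN.
    rewrite ltr_pdivlMr// in ne; apply: ltW; apply: lt_trans (zP k).2 _.
    apply: le_lt_trans ne; rewrite ler_pM2r//.
    by apply: ler_wiXn2l => //; rewrite ?invr_ge0// invf_le1// ler1n.
  - have M1 : 0 < 2 * M + 1 by rewrite ltr_wpDl// mulr_ge0.
    have [n ne] := half_pow_lt (divr_gt0 e0 M1).
    exists n => k m nk; have := sC n (k - n)%N m; rewrite subnKC// => h.
    rewrite ltr_pdivlMr ?ltr_wpDl ?mulr_ge0// in ne.
    apply: le_trans h _; apply: le_trans (ltW ne).
    have := half_gt0 n; have := mulr_ge0 M0 (ltW (half_gt0 k)); lra.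
  exists a => // m; have [n nP] := aC _ ltr01.
  have h1 := nP _ m (leqnn n); have h2 := sC 0%N n m.
  rewrite add0n expr0 /= in h2.
  have s0 : partial_sum x (fun=> 0) m = 0 by rewrite /partial_sum big1// => i _; rewrite scale0r.
  rewrite s0 subr0 in h2.
  have := rnormBl (partial_sum x a m) (partial_sum x (s n) m).
  have := mulr_ge0 M0 (ltW (half_gt0 n)); lra.
exists (2 * (2 * M + 1) / r).
have M1 : 0 < 2 * M + 1 by rewrite ltr_wpDl// !mulr_ge0.
split; first by rewrite divr_gt0// mulr_gt0.
move=> a m n mn; set y := partial_sum x a n.
have aE := @expands_truncate _ _ _ x a n; rewrite -/y in aE.
have [y0|y0] := eqVneq y 0.
  have zero_exp : expands x (fun=> 0) y.
    have := @expands_truncate _ _ _ x (fun=> 0) 0; rewrite y0.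
    by rewrite [partial_sum _ _ _]big_ord0.
  have := uniq _ _ _ aE zero_exp => /(congr1 (fun b => partial_sum x b m)).
  rewrite [RHS]/partial_sum [RHS]big1; last by move=> i _; rewrite scale0r.
  have -> : partial_sum x (fun i => if (i < n)%N then a i else 0) m = partial_sum x a m.
    by apply: eq_bigr => i _; rewrite (leq_trans (ltn_ord i) mn).
  by move=> ->; rewrite y0 !rnorm0 mulr0.
have yn : 0 < rnorm y by rewrite rnorm_gt0.
pose t := r / (2 * rnorm y).
have t0 : 0 < t by rewrite divr_gt0// mulr_gt0.
have Yy : Y y by exact: expands_closed_span aE.
have [|b bty bM] := ball_bounded (of_real t *: y) (YZ _ _ Yy).
  rewrite rnormZ rnorm_of_real gtr0_norm// /t.
  have -> : r / (2 * rnorm y) * rnorm y = r / 2 by field; rewrite gt_eqF.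
  by rewrite ltr_pdivrMr// mulr_natr mulr2n ltrDl.
have bE := uniq _ _ _ bty (expandsZ (c := of_real t) aE).
have := bM m; rewrite bE partial_sumZ rnormZ rnorm_of_real gtr0_norm//.
have -> : partial_sum x (fun i => if (i < n)%N then a i else 0) m = partial_sum x a m.
  by apply: eq_bigr => i _; rewrite (leq_trans (ltn_ord i) mn).
rewrite mulrC -ler_pdivlMr// => /le_trans; apply.
by rewrite /t le_eqVlt; apply/orP; left; apply/eqP; field; rewrite !gt_eqF.
Qed.

End BasisConstant.

(** * Non-compact operators on the span of a basis *)

Section Operators.
Context {R : realType} {cplx : bool}.
Local Notation K := (scalars R cplx).
Context {X : completeNormedModType K}.
Implicit Types (x tau : nat -> X) (a : nat -> K).

Lemma expands_unique_limit x a (y y' : X) : expands x a y -> expands x a y' -> y = y'.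
Proof.
move=> /expandsP h /expandsP h'; apply/eqP; rewrite -subr_eq0 -rnorm_eq0 eq_le rnorm_ge0 andbT.
apply/ler_addgt0Pr => e e0; have e20 : 0 < e / 2 by rewrite divr_gt0.
have [N NP] := h _ e20; have [M MP] := h' _ e20.
have h1 := NP _ (leq_maxl N M); have h2 := MP _ (leq_maxr N M).
rewrite rnorm_distC in h1.
by have := rnorm_triangle y (partial_sum x a (maxn N M)) y'; lra.
Qed.

(** On an expanded vector the operator acts termwise; domination makes the image
    series Cauchy. *)
Lemma operator_of_images (y tau : nat -> X) (D : R) :
  schauder_basis (closed_span y) y -> 0 <= D ->
  (forall a n, rnorm (partial_sum tau a n) <= D * rnorm (partial_sum y a n)) ->
  exists T : X -> X, bounded_linear_on (closed_span y) T /\ forall i, T (y i) = tau i.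
Proof.
move=> [yY ybasis] D0 dom; set Y := closed_span y.
have uniq a b v : expands y a v -> expands y b v -> a = b.
  move=> av bv; have [c [_ cU]] := ybasis v (expands_closed_span av).
  by rewrite -(cU _ av) -(cU _ bv).
have image a v : expands y a v -> exists w : X, expands tau a w.
  move=> /expandsP av.
  have [|w tw] := @cauchy_rnorm_cvg _ _ X (partial_sum tau a).
    move=> e e0; have D1 : 0 < D + 1 by rewrite ltr_wpDl.
    have e20 : 0 < e / (D + 1) / 2 by rewrite !divr_gt0.
    have [N NP] := av _ e20.
    have close m n : (N <= n)%N -> (n <= m)%N ->
        rnorm (partial_sum tau a m - partial_sum tau a n) < e.
      move=> Nn nm.
      have := dom (fun i => a i - if (i < n)%N then a i else 0) m.
      rewrite !partial_sumB !partial_sum_truncate// => h.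
      apply: le_lt_trans h _.
      have h1 := NP m (leq_trans Nn nm); have h2 := NP n Nn.
      have h3 := rnorm_triangle (partial_sum y a m) v (partial_sum y a n).
      rewrite (rnorm_distC v) in h3.
      have : rnorm (partial_sum y a m - partial_sum y a n) < e / (D + 1) by lra.
      rewrite ltr_pdivlMr//.
      by have := rnorm_ge0 (partial_sum y a m - partial_sum y a n); lra.
    exists N => m n Nm Nn; have [nm|mn] := leqP n m; first exact: close.
    by rewrite rnorm_distC close// ltnW.
  exists w; apply/expandsP => e e0; move/cvg_rnormP : tw => /(_ e e0)[N _ NP].
  by exists N => n Nn; exact: NP.
have /choice[T TP] : forall v, exists w, Y v -> exists a, expands y a v /\ expands tau a w.
  move=> v; have [Yv|] := pselect (Y v); last by exists 0.
  have [a [av _]] := ybasis v Yv; have [w aw] := image a v av.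
  by exists w => _; exists a.
have [Ylin _] := closed_subspace_span y.
exists T; split; last first.
  move=> i; have [a [ai aT]] := TP _ (yY i).
  pose d j : K := (j == i)%:R.
  have trE (z : nat -> X) : expands z (fun j => if (j < i.+1)%N then d j else 0) (z i).
    by have := @expands_truncate _ _ _ z d i.+1; rewrite partial_sum_delta.
  by apply: (expands_unique_limit aT); rewrite (uniq _ _ _ ai (@trE y)); exact: trE.
split=> [c u v Yu Yv|].
  have [a [au aT]] := TP _ Yu; have [b [bv bT]] := TP _ Yv.
  have [d [duv dT]] := TP _ (Ylin.2 c _ _ Yu Yv).
  have dE := uniq _ _ _ duv (expandsD (expandsZ (c := c) au) bv).
  apply: (expands_unique_limit dT); rewrite dE.
  exact: expandsD (expandsZ (c := c) aT) bT.
exists D => v Yv; have [a [/expandsP av /expandsP aT]] := TP _ Yv.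
apply/ler_addgt0Pr => e e0; have D1 : 0 < D + 1 by rewrite ltr_wpDl.
have e1 : 0 < e / (D + 1) by rewrite divr_gt0.
have [N NP] := av _ e1; have [M MP] := aT _ e1.
have := NP _ (leq_maxl N M); have := MP _ (leq_maxr N M); have := dom a (maxn N M).
set k := maxn N M; rewrite (rnorm_distC _ (T v)) => h1 h2 h3.
have h4 := rnormBl (T v) (partial_sum tau a k).
have h5 := rnormBl (partial_sum y a k) v.
have h6 : rnorm (partial_sum y a k) <= rnorm v + e / (D + 1) by lra.
have h7 := ler_wpM2l D0 h6.
have h8 : e = D * (e / (D + 1)) + e / (D + 1) by field; rewrite gt_eqF.
rewrite [leRHS]/= h8; lra.
Qed.

Lemma separated_not_compact (Y : set X) (S : X -> X) (w : nat -> X) (M c : R) :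
  0 < c -> (forall (t : K) u, Y u -> Y (t *: u) /\ S (t *: u) = t *: S u) ->
  (forall i, Y (w i)) -> (forall i, rnorm (w i) <= M) ->
  (forall i j, (i < j)%N -> c <= rnorm (S (w i) - S (w j))) ->
  ~ compact_on Y S.
Proof.
move=> c0 Shom Yw wM sep; rewrite /compact_on precompactE => cpt.
have M0 : 0 < M + 1 by rewrite ltr_wpDl// (le_trans (rnorm_ge0 _) (wM 0%N)).
pose s i := S (of_real (M + 1)^-1 *: w i).
have sE i : s i = of_real (M + 1)^-1 *: S (w i) by rewrite /s (Shom _ _ (Yw i)).2.
have [|p [_ clp]] := cpt (s @ \oo) _.
  exists 0%N => // i _; apply: subset_closure; exists (of_real (M + 1)^-1 *: w i) => //.
  split; first exact: (Shom _ _ (Yw i)).1.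
  rewrite rnormZ rnorm_of_real gtr0_norm ?invr_gt0// ler_pdivrMl// mulr1.
  by rewrite (le_trans (wM i))// lerDl.
pose r := c / (M + 1) / 2; have r0 : 0 < r by rewrite !divr_gt0.
have r0' : 0 < of_real r :> K by rewrite -of_real0 ltr_of_real.
have close N : exists2 i, (N <= i)%N & rnorm (p - s i) < r.
  have [] := clp (s @` [set i | (N <= i)%N]) (ball p (of_real r)).
  - by exists N => // i Ni; exists i.
  - exact: nbhsx_ballx.
  - move=> _ [[i Ni <-]]; rewrite -ball_normE /ball_ /= normr_rnorm ltr_of_real.
    by exists i.
have [i _ pi] := close 0%N; have [j ij pj] := close i.+1.
have := sep i j ij.
have : rnorm (s i - s j) < c / (M + 1).
  have := rnorm_triangle (s i) p (s j); rewrite (rnorm_distC _ p).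
  by rewrite /r in pi pj; lra.
rewrite !sE -scalerBr rnormZ rnorm_of_real gtr0_norm ?invr_gt0//.
by rewrite mulrC ltr_pM2r ?invr_gt0// leNgt => ->.
Qed.

(** The even terms carry the operator and the odd ones are killed, so the odd
    terms rule out every lambda different from 0 and the even ones rule out 0. *)
Lemma noncompact_operator (y tau : nat -> X) (C D M c d : R) :
  0 < c -> (forall a n i, (i < n)%N -> c * rnorm (a i) <= rnorm (partial_sum y a n)) ->
  (forall a m n, (m <= n)%N ->
    rnorm (partial_sum y a m) <= C * rnorm (partial_sum y a n)) ->
  (forall i, rnorm (y i) <= M) ->
  0 <= D -> (forall a n, rnorm (partial_sum tau a n) <= D * rnorm (partial_sum y a n)) ->
  (forall i, odd i -> tau i = 0) ->
  0 < d ->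
  (forall i j, (i < j)%N -> d <= rnorm (tau i.*2 - tau j.*2)) ->
  exists Y : set X,
    [/\ closed_subspace Y,
        exists e : nat -> X, schauder_basis Y e &
        exists T : X -> X,
          bounded_linear_on Y T /\
          forall lambda : K, ~ compact_on Y (fun v => T v - lambda *: v)].
Proof.
move=> c0 ycoord yconst yM D0 dom tau_odd d0 tau_sep.
have sub (z : nat -> X) i j : (i < j)%N ->
    z i - z j = partial_sum z (fun k => (k == i)%:R - (k == j)%:R) j.+1.
  move=> ij; rewrite partial_sumB partial_sum_delta; congr (_ - _).
  rewrite -(partial_sum_delta z i) -(partial_sum_truncate _ _ (leqW ij)).
  apply: eq_bigr => k _; congr (_ *: _).
  by rewrite ltnS; case: (ltngtP k i) => // ->; rewrite eqxx.
have y0 i : y i != 0.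
  rewrite -rnorm_gt0; apply: lt_le_trans c0 _.
  have := ycoord (fun k => (k == i)%:R) i.+1 i (leqnn _).
  by rewrite partial_sum_delta eqxx rnorm1 mulr1.
have ysep i j : (i < j)%N -> c <= rnorm (y i - y j).
  move=> ij; rewrite sub//.
  have := ycoord (fun k => (k == i)%:R - (k == j)%:R) j.+1 i (leqW ij).
  by rewrite eqxx ltn_eqF// subr0 rnorm1 mulr1.
have ybasis := schauder_basis_of_constant y0 yconst.
exists (closed_span y); split; first exact: closed_subspace_span.
  by exists y.
have [T [Tbl Ty]] := operator_of_images ybasis D0 dom.
exists T; split => // lambda.
have [[Y0 Ylin] _] := closed_subspace_span y.
have [Tlin _] := Tbl.
have T0 : T 0 = 0.
  have := Tlin 1 0 0 Y0 Y0; rewrite !scale1r addr0 => /esym/eqP.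
  by rewrite -subr_eq0 addrK => /eqP.
have hom (t : K) u : closed_span y u -> closed_span y (t *: u) /\
    T (t *: u) - lambda *: (t *: u) = t *: (T u - lambda *: u).
  move=> Yu; split; first by rewrite -[_ *: _]addr0; exact: Ylin.
  have := Tlin t u 0 Yu Y0; rewrite !addr0 T0 addr0 => ->.
  by rewrite scalerBr !scalerA mulrC.
have [l0|l0] := eqVneq lambda 0.
  apply: (separated_not_compact (w := fun i => y i.*2) d0 hom).
  - by move=> i; exact: closed_span_gen.
  - by move=> i; exact: yM.
  - by move=> i j ij; rewrite l0 !scale0r !subr0 !Ty tau_sep.
have lgt : 0 < rnorm lambda by rewrite rnorm_gt0.
apply: (separated_not_compact (w := fun i => y i.*2.+1) (mulr_gt0 lgt c0) hom).
- by move=> i; exact: closed_span_gen.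
- by move=> i; exact: yM.
- move=> i j ij; rewrite !Ty !tau_odd /= ?odd_double// !sub0r -opprD rnormN -scalerBr.
  by rewrite rnormZ ler_pM2l// ysep// ltnS ltn_double.
Qed.

End Operators.

(** * Sums of differences *)

Section PairedSums.
Context {R : realType} {cplx : bool}.
Local Notation K := (scalars R cplx).

(** The enumeration is continued past the elements of F so as to be increasing on
    all of nat, as the index sequences of spreading models are. *)
Lemma enumerate_increasing (F : pred nat) (n T : nat) :
  (forall i, F i -> (n <= i)%N) -> (n <= T)%N ->
  exists iota_F : nat -> nat, [/\ {homo iota_F : i j / (i < j)%N},
    forall s, (n <= iota_F s)%N,
    forall s, (s < count F (iota 0 T))%N -> F (iota_F s) /\ (iota_F s < T)%N &
    forall (V : zmodType) (f : nat -> V),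
      \sum_(i < T | F i) f i = \sum_(s < count F (iota 0 T)) f (iota_F s)].
Proof.
move=> Fn nT; pose q := [seq i <- iota 0 T | F i].
have qE : size q = count F (iota 0 T) by rewrite size_filter.
have qP s : (s < size q)%N -> F (nth 0%N q s) /\ (nth 0%N q s < T)%N.
  by move=> /(mem_nth 0%N); rewrite mem_filter mem_iota => /andP[? /andP[_]].
have q_sorted : sorted ltn q by apply: (sorted_filter ltn_trans); exact: iota_ltn_sorted.
exists (fun s => if (s < size q)%N then nth 0%N q s else (T + s)%N); split.
- move=> i j ij; case: (ltnP j (size q)) => jq.
    by rewrite (ltn_trans ij jq) (sorted_ltn_nth ltn_trans)// ?inE// (ltn_trans ij).
  case: ifPn => [iq|_]; last by rewrite ltn_add2l.
  by apply: leq_trans (qP _ iq).2 _; exact: leq_addr.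
- move=> s; case: ifPn => [sq|_]; first exact: Fn (qP _ sq).1.
  by rewrite (leq_trans nT)// leq_addr.
- by move=> s; rewrite -qE => sq; rewrite sq; exact: qP.
- move=> V f; rewrite -(big_mkord (fun i => F i) f) /index_iota subn0 -big_filter -/q (big_nth 0%N).
  by rewrite -qE big_mkord; apply: eq_bigr => s _; rewrite ltn_ord.
Qed.

(** The coefficients that turn the sum of a_s (x_(2s) - x_(2s+1)) into a
    combination of the x_i. *)
Definition alternate (a : nat -> K) (i : nat) : K :=
  if odd i then - a i./2 else a i./2.

Lemma rnorm_alternate a i : rnorm (alternate a i) = rnorm (a i./2).
Proof. by rewrite /alternate; case: ifP; rewrite ?rnormN. Qed.

Lemma partial_sum_alternate (V : completeNormedModType K) (x : nat -> V) a l :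
  partial_sum x (alternate a) l.*2 = \sum_(s < l) a s *: (x s.*2 - x s.*2.+1).
Proof.
elim: l => [|l IH]; first by rewrite /partial_sum !big_ord0.
rewrite doubleS !partial_sumS IH [RHS]big_ord_recr /= /alternate /= odd_double /=.
by rewrite uphalf_double doubleK scaleNr -addrA scalerBr.
Qed.

Lemma sum_ord_alternate (V : completeNormedModType K) (x : nat -> V) a l n :
  (l.*2 <= n)%N ->
  \sum_(i < n) (if (i < l.*2)%N then alternate a i else 0) *: x i
  = \sum_(s < l) a s *: (x s.*2 - x s.*2.+1).
Proof.
move=> ln; rewrite -partial_sum_alternate -(partial_sum_truncate _ _ ln).
by [].
Qed.

(** Padding with zero coefficients to a large length n gives the error eps_n for
    combinations of bounded length. *)
Lemma spreading_differences (V W : completeNormedModType K) (x : nat -> V)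
    (xt : nat -> W) (L : nat) (e : R) : spreading_model x xt -> 0 < e ->
  exists N, forall (kappa : nat -> nat) (l : nat) (a : nat -> K),
    {homo kappa : i j / (i < j)%N} -> (l <= L)%N -> (N <= kappa 0)%N ->
    (forall s, (s < l)%N -> rnorm (a s) <= 1) ->
    `|rnorm (\sum_(s < l) a s *: (x (kappa s.*2) - x (kappa s.*2.+1)))
      - rnorm (\sum_(s < l) a s *: (xt s.*2 - xt s.*2.+1))| <= e.
Proof.
move=> [_ _ [eps [_ eps0 spread]]] e0.
have /cvgrPdist_lt /(_ _ e0)[N0 _ N0P] := eps0.
pose n := (maxn N0 L.*2).+1; exists n => kappa l a kappaS lL Nk a1.
have ln : (l.*2 <= n)%N.
  by rewrite /n leqW// (leq_trans _ (leq_maxr _ _))// leq_double.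
have kge i : (kappa 0%N + i <= kappa i)%N.
  elim: i => [|i IH]; first by rewrite addn0.
  by rewrite addnS; apply: leq_ltn_trans IH _; exact: kappaS.
have := spread n (ltn0Sn _)
  (fun i : 'I_n => if (i < l.*2)%N then alternate a i else 0) (fun i : 'I_n => kappa i).
rewrite (sum_ord_alternate xt a ln) (sum_ord_alternate (fun i => x (kappa i)) a ln).
move=> H; apply: ltW; apply: lt_trans (H _ _ _) _.
- move=> i; case: ifPn => [il|_]; last by rewrite rnorm0.
  by rewrite rnorm_alternate a1// -ltn_double (leq_ltn_trans _ il)// halfK leq_subr.
- by move=> i j; exact: kappaS.
- by move=> i; apply: leqW; apply: leq_trans Nk (leq_trans (leq_addr i _) (kge i)).
- have := N0P n (leqW (leq_maxl _ _)); rewrite /= sub0r normrN.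
  by apply: le_lt_trans; exact: ler_norm.
Qed.

Lemma fin_dominated_differences (V W : completeNormedModType K) (z : nat -> V)
    (xt : nat -> W) (n : nat) (C : R) (l : nat) (a : nat -> K) :
  fin_dominated n C z xt -> (l.*2 <= n)%N ->
  rnorm (\sum_(s < l) a s *: (z s.*2 - z s.*2.+1))
    <= C * rnorm (\sum_(s < l) a s *: (xt s.*2 - xt s.*2.+1)).
Proof.
move=> dom ln.
have := dom (fun i : 'I_n => if (i < l.*2)%N then alternate a i else 0).
by rewrite (sum_ord_alternate xt a ln) (sum_ord_alternate z a ln).
Qed.

(** The bound 1 + N, instead of a case distinction on the norm N of the
    combination of z, comes from rescaling when N > 1. *)
Lemma small_dominated_differences (V W : completeNormedModType K) (xt : nat -> V)
    (z : nat -> W) (eta : R) : small_dominated xt z -> 0 < eta ->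
  exists2 delta : R, 0 < delta & forall l (a : nat -> K),
    (forall s, (s < l)%N -> rnorm (a s) <= delta) ->
    rnorm (\sum_(s < l) a s *: (xt s.*2 - xt s.*2.+1))
      <= eta * (1 + rnorm (\sum_(s < l) a s *: (z s.*2 - z s.*2.+1))).
Proof.
move=> small eta0.
have near_delta : \forall e \near (0 : R)^'+, (Delta z xt e < eta%:E)%E.
  have nb : nbhs (0%E : \bar R) (fun u => (u < eta%:E)%E).
    by apply: open_ereal_lt'; rewrite lte_fin.
  exact: small nb.
have [delta [/= delta0 small_delta]] := filter_ex
  (filterI (@nbhs_right_gt R 0) near_delta).
exists delta => // l a adelta.
have base (b : nat -> K) : (forall s, (s < l)%N -> rnorm (b s) <= delta) ->
    rnorm (\sum_(s < l) b s *: (z s.*2 - z s.*2.+1)) <= 1 ->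
    rnorm (\sum_(s < l) b s *: (xt s.*2 - xt s.*2.+1)) <= eta.
  move=> bdelta bz; rewrite -lee_fin; apply: le_trans (ltW small_delta).
  apply: ereal_sup_ubound; exists l.*2, (fun i : 'I_(l.*2) => alternate b i).
  split.
  - move=> i; rewrite rnorm_alternate bdelta// -ltn_double.
    by rewrite (leq_ltn_trans _ (ltn_ord i))// halfK leq_subr.
  - by have := partial_sum_alternate z b l; rewrite /partial_sum => ->.
  - by congr (rnorm _)%:E; have := partial_sum_alternate xt b l; rewrite /partial_sum => ->.
set N := rnorm (\sum_(s < l) a s *: (z _ - z _)).
have N0 : 0 <= N by exact: rnorm_ge0.
have [N1|N1] := leP N 1.
  by apply: le_trans (base a adelta N1) _; rewrite ler_pMr// lerDl.
have Ngt0 : 0 < N by exact: lt_trans N1.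
have scaled (U : completeNormedModType K) (u : nat -> U) :
    rnorm (\sum_(s < l) (of_real N^-1 * a s) *: u s) = N^-1 * rnorm (\sum_(s < l) a s *: u s).
  rewrite -[N^-1 in RHS](gtr0_norm (_ : 0 < N^-1)) ?invr_gt0//.
  rewrite -(@rnorm_of_real _ cplx) -rnormZ scaler_sumr.
  by congr rnorm; apply: eq_bigr => s _; rewrite scalerA.
have := base (fun s => of_real N^-1 * a s).
rewrite (scaled _ (fun s => z s.*2 - z s.*2.+1)) (scaled _ (fun s => xt s.*2 - xt s.*2.+1)).
rewrite -/N mulVf ?gt_eqF// lexx => H.
have : N^-1 * rnorm (\sum_(s < l) a s *: (xt s.*2 - xt s.*2.+1)) <= eta.
  apply: H => // s sl; rewrite -[_ * _]/(_ *: (a s : K^o)) (@rnormZ _ _ K^o).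
  rewrite rnorm_of_real gtr0_norm ?invr_gt0// ler_pdivrMl//.
  rewrite (le_trans (adelta s sl))// ler_peMl ?(ltW delta0)// ltW//.
rewrite ler_pdivrMl// => /le_trans; apply.
by rewrite mulrDr mulr1 mulrC lerDr ltW.
Qed.

Lemma property_P2_count (V : completeNormedModType K) (x : nat -> V) (rho : R) :
  property_P2 x -> 0 < rho -> exists M : nat, forall (a : nat -> K) (n l : nat)
    (kappa : nat -> nat), {homo kappa : i j / (i < j)%N} ->
    rnorm (partial_sum x a n) = 1 ->
    (forall s, (s < l)%N -> (kappa s < n)%N /\ rho <= rnorm (a (kappa s))) ->
    (l <= M)%N.
Proof.
move=> P2 rho0; have [M MP] := P2 rho rho0; exists M => a n l kappa kappaS an large.
have := MP _ _ (@expands_truncate _ _ _ x a n) an; rewrite -card_le_II.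
apply: card_le_trans.
have kinj : {in `I_l &, injective kappa}.
  move=> i j _ _ kij; case: (ltngtP i j) => // /kappaS; rewrite kij ltnn//.
rewrite -(card_le_eql (inj_card_eq kinj)).
apply: subset_card_le => _ [s sl <-] /=.
by have [kn ka] := large s sl; rewrite kn.
Qed.

End PairedSums.

(** * The diagonal sequence *)

Section Blocks.

(** Position t = i * i + m with m <= 2 i belongs to block i and to row m. *)
Definition row_of (t : nat) : nat := (t - PeanoNat.Nat.sqrt t * PeanoNat.Nat.sqrt t)%N.

Lemma sqrt_block (i m : nat) : (m < i.*2.+1)%N -> PeanoNat.Nat.sqrt (i * i + m) = i.
Proof. by move=> mi; apply: PeanoNat.Nat.sqrt_unique; lia. Qed.

Lemma row_of_block (i m : nat) : (m < i.*2.+1)%N -> row_of (i * i + m) = m.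
Proof. by move=> mi; rewrite /row_of sqrt_block// addKn. Qed.

Lemma row_of_le t : (row_of t <= t)%N.
Proof. exact: leq_subr. Qed.

Lemma block_sum (V : nmodType) (f : nat -> V) (I : nat) :
  \sum_(t < I * I) f t = \sum_(i < I) \sum_(m < i.*2.+1) f (i * i + m)%N.
Proof.
elim: I => [|I IH]; first by rewrite !big_ord0.
rewrite [RHS]big_ord_recr /= -IH.
have -> : (I.+1 * I.+1 = I * I + I.*2.+1)%N by lia.
by rewrite big_split_ord.
Qed.

Lemma row_sum (V : nmodType) (F : pred nat) (n I : nat) (f : nat -> V) :
  (forall i, F i -> (n <= i)%N) ->
  \sum_(t < I * I | (row_of t == n) && F (PeanoNat.Nat.sqrt t)) f t
  = \sum_(i < I | F i) f (i * i + n)%N.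
Proof.
move=> Fn; rewrite big_mkcond.
rewrite (block_sum (fun t => if (row_of t == n) && F (PeanoNat.Nat.sqrt t) then f t else 0)).
rewrite [RHS]big_mkcond; apply: eq_bigr => i _.
under eq_bigr => m _ do rewrite row_of_block ?sqrt_block//.
have [Fi|nFi] := boolP (F i); last by rewrite big1// => m _; rewrite andbF.
have ni : (n < i.*2.+1)%N by have := Fn _ Fi; lia.
rewrite (bigD1 (Ordinal ni))//= eqxx /= big1 ?addr0// => m.
by rewrite -val_eqE /= => /negbTE ->.
Qed.

End Blocks.

Section Diagonal.
Context {R : realType} {cplx : bool}.
Local Notation K := (scalars R cplx).
Context {X : completeNormedModType K} (u : nat -> X) (l : nat -> nat) (e B : R).
Hypothesis e0 : 0 < e.
Hypothesis u_select : forall (n T : nat) (F : pred nat) (b : nat -> K),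
  (forall t, F t -> (n <= t)%N /\ row_of t = n) ->
  (forall t, rnorm (b t) <= 1) ->
  (n <= T)%N -> (count F (iota 0 T) <= l n)%N ->
  rnorm (\sum_(s < T | (s < n)%N || F s) b s *: u s)
    <= rnorm (\sum_(s < T) b s *: u s) + e.
Hypothesis l0 : (0 < l 0)%N.
Hypothesis u_ge : forall i, 4 * e <= rnorm (u (i * i)%N).
Hypothesis u_le : forall t, rnorm (u t) <= B.

(** The sequence y of the introduction. *)
Definition diagonal (i : nat) : X :=
  \sum_(m < i.*2.+1) of_real (2^-1 ^+ m) *: u (i * i + m)%N.

Let beta (b : nat -> K) t : K := of_real (2^-1 ^+ row_of t) * b (PeanoNat.Nat.sqrt t).

Let pow_half n : 0 < 2^-1 ^+ n :> R. Proof. by rewrite exprn_gt0// invr_gt0. Qed.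

Let rnormM (s t : K) : rnorm (s * t) = rnorm s * rnorm t.
Proof. by rewrite -[s * t]/(s *: (t : K^o)) (@rnormZ _ _ K^o). Qed.

Let beta1 b : (forall i, rnorm (b i) <= 1) -> forall t, rnorm (beta b t) <= 1.
Proof.
move=> b1 t; rewrite /beta rnormM rnorm_of_real gtr0_norm//.
rewrite mulr_ile1 ?rnorm_ge0 ?(ltW (pow_half _))//.
by rewrite exprn_ile1 ?invr_ge0// invf_le1// ler1n.
Qed.

Let beta_sum (b : nat -> K) I : \sum_(t < I * I) beta b t *: u t = partial_sum diagonal b I.
Proof.
rewrite (block_sum (fun t => beta b t *: u t)); apply: eq_bigr => i _.
rewrite scaler_sumr; apply: eq_bigr => m _.
by rewrite /beta row_of_block// sqrt_block// scalerA mulrC.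
Qed.

Lemma rnorm_diagonal_le i : rnorm (diagonal i) <= 2 * B.
Proof.
have B0 : 0 <= B by apply: le_trans (rnorm_ge0 _) (u_le 0%N).
apply: le_trans (rnorm_sum _ _ _) _.
apply: le_trans (sum_geometric_le i.*2.+1 (mulr_ge0 (ler0n _ 2) B0)).
apply: ler_sum => m _; rewrite rnormZ rnorm_of_real gtr0_norm//.
have -> : 2 * B * 2^-1 ^+ m.+1 = 2^-1 ^+ m * B by rewrite exprS; field.
by rewrite ler_pM2l.
Qed.

(** [selection] with nothing kept beyond the initial segment. *)
Let prefix1 (b : nat -> K) m I : (forall i, rnorm (b i) <= 1) -> (m <= I)%N ->
  rnorm (partial_sum diagonal b m) <= rnorm (partial_sum diagonal b I) + e.
Proof.
move=> b1 mI; rewrite -!beta_sum.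
have mI2 : (m * m <= I * I)%N by rewrite leq_mul.
have := @u_select (m * m) (I * I) pred0 (beta b) (fun _ => _) (beta1 b1) mI2.
rewrite count_pred0 => /(_ _ isT); set S := (X in rnorm X <= _).
suff -> : S = \sum_(t < m * m) beta b t *: u t by apply.
rewrite /S -(big_mkord (fun s => (s < m * m)%N || false) (fun s => beta b s *: u s)).
rewrite (big_cat_nat (leq0n (m * m)) mI2) /= [X in _ + X]big_nat_cond [X in _ + X]big1 ?addr0.
  by rewrite big_mkord; apply: eq_bigl => s; rewrite ltn_ord.
by move=> s; rewrite orbF => /andP[/andP[ms _]]; rewrite ltnNge ms.
Qed.

(** The indices of F in row n give positions t = i * i + n; keep those and the
    positions below n, then subtract the latter. *)
Let row1 (b : nat -> K) n I (F : pred nat) : (forall i, rnorm (b i) <= 1) ->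
  (forall i, F i -> (n <= i)%N) -> (count F (iota 0 I) <= l n)%N ->
  rnorm (\sum_(i < I | F i) b i *: u (i * i + n)%N)
    <= 2 ^+ n * (2 * rnorm (partial_sum diagonal b I) + 2 * e).
Proof.
move=> b1 Fn cF; have [In|nI] := leqP I n.
  rewrite big_pred0 ?rnorm0; first by rewrite mulr_ge0 ?exprn_ge0 ?addr_ge0 ?mulr_ge0 ?rnorm_ge0 ?(ltW e0).
  by move=> i; apply/negP => /Fn; rewrite leqNgt (leq_trans (ltn_ord i) In).
pose G t := (row_of t == n) && F (PeanoNat.Nat.sqrt t).
have nT : (n <= I * I)%N by nia.
have GP t : G t -> (n <= t)%N /\ row_of t = n.
  by move=> /andP[/eqP <- _]; split => //; exact: row_of_le.
have cG : (count G (iota 0 (I * I)) <= l n)%N.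
  have cE (A : pred nat) T : count A (iota 0 T) = (\sum_(t < T | A t) 1)%N.
    by rewrite -sum1_count -(big_mkord (fun t => A t) (fun=> 1%N)) /index_iota subn0.
  apply: leq_trans cF; rewrite !cE eq_leq//.
  exact: (@row_sum nat F n I (fun=> 1%N) Fn).
have h1 := u_select GP (beta1 b1) nT cG.
have h2 := @u_select n (I * I) pred0 (beta b) (fun _ => _) (beta1 b1) nT.
rewrite count_pred0 in h2; have {}h2 := h2 _ isT.
have E1 : \sum_(s < I * I | (s < n)%N || G s) beta b s *: u s
    = \sum_(s < I * I | (s < n)%N || pred0 (nat_of_ord s)) beta b s *: u s
      + \sum_(s < I * I | G s) beta b s *: u s.
  rewrite (bigID (fun s : 'I__ => (s < n)%N)) /=; congr (_ + _).
    by apply: eq_bigl => s; case: (s < n)%N; rewrite ?andbT ?andbF.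
  apply: eq_bigl => s; have [sn|_] /= := ltnP s n; last by rewrite andbT.
  by apply/esym/negP => /GP[]; rewrite leqNgt sn.
have E2 : \sum_(s < I * I | G s) beta b s *: u s
    = of_real (2^-1 ^+ n) *: \sum_(i < I | F i) b i *: u (i * i + n)%N.
  rewrite (row_sum I (fun s => beta b s *: u s) Fn) scaler_sumr.
  apply: eq_bigr => i Fi; have ni : (n < i.*2.+1)%N by have := Fn _ Fi; lia.
  by rewrite /beta row_of_block// sqrt_block// scalerA.
rewrite E1 beta_sum in h1; rewrite beta_sum in h2.
rewrite -ler_pdivrMl ?exprn_gt0// -exprVn.
rewrite -(gtr0_norm (pow_half n)) -(@rnorm_of_real _ cplx) -rnormZ -E2.
move: h1 h2; set Q := \sum_(s < I * I | G s) _; set P := \sum_(s < I * I | _) _.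
move=> h1 h2; have {}h2 : rnorm P <= rnorm (partial_sum diagonal b I) + e by exact: h2.
by have := rnormB (P + Q) P; rewrite addrAC subrr add0r; lra.
Qed.

Let scale (S : R) (V : completeNormedModType K) I (F : pred nat) (b : nat -> K) (w : nat -> V) : 0 < S ->
  \sum_(i < I | F i) (of_real S^-1 * (if (i < I)%N then b i else 0)) *: w i
  = of_real S^-1 *: \sum_(i < I | F i) b i *: w i.
Proof.
by move=> S0; rewrite scaler_sumr; apply: eq_bigr => i _; rewrite ltn_ord scalerA.
Qed.

Let normalized (S : R) I (b : nat -> K) : 0 < S -> (forall i, (i < I)%N -> rnorm (b i) <= S) ->
  forall i, rnorm (of_real S^-1 * (if (i < I)%N then b i else 0)) <= 1.
Proof.
move=> S0 bS i; rewrite rnormM rnorm_of_real gtr0_norm ?invr_gt0// ler_pdivrMl// mulr1.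
by case: ifP => [/bS//|_]; rewrite rnorm0 ltW.
Qed.

Let row_scaled S (b : nat -> K) n I (F : pred nat) : 0 < S -> (forall i, (i < I)%N -> rnorm (b i) <= S) ->
  (forall i, F i -> (n <= i)%N) -> (count F (iota 0 I) <= l n)%N ->
  rnorm (\sum_(i < I | F i) b i *: u (i * i + n)%N)
    <= 2 ^+ n * (2 * rnorm (partial_sum diagonal b I) + 2 * e * S).
Proof.
move=> S0 bS Fn cF; have := row1 (normalized S0 bS) Fn cF.
rewrite /partial_sum (scale I F b (fun i => u (i * i + n)%N) S0).
rewrite (scale I xpredT b diagonal S0) !rnormZ rnorm_of_real gtr0_norm ?invr_gt0//.
rewrite ler_pdivrMl// => /le_trans; apply; rewrite le_eqVlt; apply/orP; left.
by apply/eqP; field; rewrite gt_eqF.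
Qed.

(** Row 0 with a single index, the one of largest modulus: the error 2 e |b_i| of
    [selection] is half of the lower bound 4 e |b_i| for the kept term. *)
Lemma diagonal_coordinate (b : nat -> K) I i : (i < I)%N ->
  e * rnorm (b i) <= rnorm (partial_sum diagonal b I).
Proof.
move=> iI; pose i1 : 'I_I := [arg max_(j > Ordinal iI) rnorm (b j)]%O.
have max_i1 (j : 'I_I) : rnorm (b j) <= rnorm (b i1).
  by rewrite /i1; case: Order.TotalTheory.arg_maxP => //= k _; apply.
apply: le_trans (_ : e * rnorm (b i1) <= _).
  by rewrite ler_pM2l//; exact: (max_i1 (Ordinal iI)).
have [S0|] := ltP 0 (rnorm (b i1)); last first.
  move=> h; have -> : rnorm (b i1) = 0 by apply/eqP; rewrite eq_le h rnorm_ge0.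
  by rewrite mulr0 rnorm_ge0.
have bS j : (j < I)%N -> rnorm (b j) <= rnorm (b i1).
  by move=> jI; exact: (max_i1 (Ordinal jI)).
have := row_scaled (n := 0) (F := pred1 (i1 : nat)) S0 bS (fun _ _ => leq0n _).
have c1 : (count (pred1 (i1 : nat)) (iota 0 I) <= l 0)%N.
  by rewrite count_uniq_mem ?iota_uniq// (leq_trans (leq_b1 _)).
move=> /(_ c1); rewrite (big_pred1 i1) => [|j]; last by rewrite /= -val_eqE.
rewrite expr0 mul1r addn0 rnormZ => h.
have := ler_wpM2l (ltW S0) (u_ge i1); lra.
Qed.

Lemma diagonal_eq0 (b : nat -> K) I : rnorm (partial_sum diagonal b I) = 0 ->
  forall i, (i < I)%N -> b i = 0.
Proof.
move=> A0 i iI; apply/eqP; rewrite -rnorm_eq0 eq_le rnorm_ge0 andbT.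
by have := diagonal_coordinate b iI; rewrite A0 pmulr_rle0.
Qed.

Let coordinate_le (b : nat -> K) I : forall i, (i < I)%N ->
  rnorm (b i) <= rnorm (partial_sum diagonal b I) / e.
Proof. by move=> i iI; rewrite ler_pdivlMr// mulrC diagonal_coordinate. Qed.

Lemma diagonal_constant (b : nat -> K) m I : (m <= I)%N ->
  rnorm (partial_sum diagonal b m) <= 2 * rnorm (partial_sum diagonal b I).
Proof.
move=> mI; have [A0|] := ltP 0 (rnorm (partial_sum diagonal b I)); last first.
  move=> h; have A0 : rnorm (partial_sum diagonal b I) = 0.
    by apply/eqP; rewrite eq_le h rnorm_ge0.
  rewrite A0 mulr0 [partial_sum _ _ m]big1 ?rnorm0// => i _.
  by rewrite (diagonal_eq0 A0) ?scale0r// (leq_trans (ltn_ord i)).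
set S := rnorm (partial_sum diagonal b I) / e.
have S0 : 0 < S by rewrite divr_gt0.
have := prefix1 (normalized S0 (@coordinate_le b I)) mI.
rewrite /partial_sum (scale I xpredT b diagonal S0).
have -> : \sum_(i < m) (of_real S^-1 * (if (i < I)%N then b i else 0)) *: diagonal i
    = of_real S^-1 *: \sum_(i < m) b i *: diagonal i.
  rewrite scaler_sumr; apply: eq_bigr => i _.
  by rewrite (leq_trans (ltn_ord i) mI) scalerA.
rewrite !rnormZ rnorm_of_real gtr0_norm ?invr_gt0// ler_pdivrMl//.
move=> /le_trans; apply; rewrite mulrDr mulrA divff ?gt_eqF// mul1r /S.
by rewrite divfK ?gt_eqF// /partial_sum; lra.
Qed.

Lemma diagonal_row (b : nat -> K) n I (F : pred nat) :
  (forall i, F i -> (n <= i)%N) -> (count F (iota 0 I) <= l n)%N ->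
  rnorm (\sum_(i < I | F i) b i *: u (i * i + n)%N)
    <= 4 * 2 ^+ n * rnorm (partial_sum diagonal b I).
Proof.
move=> Fn cF; have [A0|] := ltP 0 (rnorm (partial_sum diagonal b I)); last first.
  move=> h; have A0 : rnorm (partial_sum diagonal b I) = 0.
    by apply/eqP; rewrite eq_le h rnorm_ge0.
  rewrite A0 mulr0 big1 ?rnorm0// => i _.
  by rewrite (diagonal_eq0 A0) ?scale0r.
have := row_scaled (divr_gt0 A0 e0) (@coordinate_le b I) Fn cF.
move=> /le_trans; apply; rewrite le_eqVlt; apply/orP; left.
by apply/eqP; field; rewrite gt_eqF.
Qed.

End Diagonal.

(** * Domination by levels *)

Section LevelSets.
Context {R : realType} {cplx : bool}.
Local Notation K := (scalars R cplx).

(** One coefficient sequence serves for all spaces V, so that it can be used on both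
    sides of a domination. *)
Lemma subsequence_coefficients (kappa : nat -> nat) (c : nat -> K) (N : nat) :
  {homo kappa : i j / (i < j)%N} ->
  exists a : nat -> K, (forall j, (j < N)%N -> a (kappa j) = c j) /\
    forall (V : completeNormedModType K) (x : nat -> V),
      partial_sum x a (kappa N) = partial_sum (fun j => x (kappa j)) c N.
Proof.
move=> kappaS; have kinj i j : kappa i = kappa j -> i = j.
  by move=> kij; case: (ltngtP i j) => // /kappaS; rewrite kij ltnn.
exists (fun k => \sum_(j < N | kappa j == k) c j); split.
  move=> j jN; rewrite (big_pred1 (Ordinal jN))// => i /=.
  by apply/eqP/eqP => [/kinj ij|->//]; exact: val_inj.
move=> V x; rewrite /partial_sum.
under eq_bigr => k _ do rewrite scaler_suml.
rewrite (exchange_big_dep xpredT)//=; apply: eq_bigr => j _.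
have kN : (kappa j < kappa N)%N by apply: kappaS; exact: ltn_ord.
by rewrite (big_pred1 (Ordinal kN)).
Qed.

Lemma rnorm_sum_count (V : completeNormedModType K) (F : pred nat) (T : nat)
    (f : nat -> V) (M : R) :
  (forall i, (i < T)%N -> F i -> rnorm (f i) <= M) ->
  rnorm (\sum_(i < T | F i) f i) <= (count F (iota 0 T))%:R * M.
Proof.
move=> fM; apply: le_trans (rnorm_sum _ _ _) _.
apply: le_trans (_ : \sum_(i < T | F i) M <= _).
  by apply: ler_sum => i Fi; exact: fM.
have [g [_ _ _ gE]] := @enumerate_increasing F 0 T (fun _ _ => leq0n _) (leq0n T).
by rewrite (gE R (fun=> M)) sumr_const card_ord mulr_natl.
Qed.

Lemma count_lt (F : pred nat) (m T : nat) : (forall i, F i -> (i < m)%N) ->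
  (count F (iota 0 T) <= m)%N.
Proof.
move=> Fm.
have [g [gS _ gF _]] := @enumerate_increasing F 0 T (fun _ _ => leq0n _) (leq0n T).
rewrite leqNgt; apply/negP => mc; have [/Fm gm _] := gF m mc.
have : (m <= g m)%N by elim: (m) => // k IH; apply: leq_ltn_trans IH (gS _ _ (ltnSn k)).
by rewrite leqNgt gm.
Qed.

Lemma level_of (delta : nat -> R) (t : R) : 0 < t -> t < delta 0 ->
  (forall m, delta m <= 2^-1 ^+ m) -> exists m, delta m.+1 <= t < delta m.
Proof.
move=> t0 td dm.
have ex : exists m, delta m.+1 <= t.
  have [m mt] := half_pow_lt t0; exists m; apply: le_trans (dm _) (le_trans _ (ltW mt)).
  by rewrite exprS ler_piMl ?exprn_ge0 ?invr_ge0// invf_le1// ler1n.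
exists (ex_minn ex); case: ex_minnP => -[|m] -> min_m /=; first by rewrite td.
by rewrite ltNge; apply/negP => /min_m; rewrite ltnn.
Qed.

(** The level decomposition.  For a vector of norm 1, the coefficients of modulus
    at least delta 0 are few and each is bounded by a coordinate of y; the levels
    contribute a geometric series of total at most (3 + C A) / 8, with A the norm of
    the combination of y.  The constant 3 / 8 is absorbed on the left. *)
Lemma level_domination (X X' : completeNormedModType K) (y : nat -> X) (x : nat -> X')
    (kappa : nat -> nat) (delta : nat -> R) (M : nat -> nat) (e B C : R) :
  let gap i := x (kappa i.*2) - x (kappa i.*2.+1) in
  0 < e -> 0 <= C -> {homo kappa : i j / (i < j)%N} ->
  (forall k, rnorm (x k) <= B) ->
  (forall m, 0 < delta m) -> (forall m, delta m <= 2^-1 ^+ m) ->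
  (forall m, m%:R * (delta m * (2 * B)) <= 2^-1 ^+ (m + 4)) ->
  (forall (b : nat -> K) I i, (i < I)%N -> e * rnorm (b i) <= rnorm (partial_sum y b I)) ->
  (forall m (a : nat -> K) n l (g : nat -> nat), {homo g : i j / (i < j)%N} ->
    rnorm (partial_sum x a n) = 1 ->
    (forall s, (s < l)%N -> (g s < n)%N /\ delta m <= rnorm (a (g s))) -> (l <= M m)%N) ->
  (forall m (F : pred nat) (b : nat -> K) I, (forall i, F i -> (m <= i)%N) ->
    (count F (iota 0 I) <= M m.+1)%N ->
    (forall i, F i -> rnorm (b i) <= delta m) ->
    rnorm (\sum_(i < I | F i) b i *: gap i)
      <= 2^-1 ^+ (m + 4) * (2 + C * rnorm (partial_sum y b I))) ->
  exists2 D : R, 0 <= D & forall (E : pred nat) (b : nat -> K) I,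
    rnorm (\sum_(i < I | E i) b i *: gap i) <= D * rnorm (partial_sum y b I).
Proof.
move=> gap e0 C0 kappaS xB delta0 delta_pow delta_small coord P2 class.
have B0 : 0 <= B by apply: le_trans (rnorm_ge0 _) (xB 0%N).
have gapB i : rnorm (gap i) <= 2 * B.
  by rewrite (le_trans (rnormB _ _))// mulr2n mulrDl mul1r lerD.
pose D0 : R := (M 0)%:R * (2 * B) / e.
have D00 : 0 <= D0 by rewrite !mulr_ge0// invr_ge0 ltW.
exists (2 * (D0 + C)); first by rewrite mulr_ge0// addr_ge0.
move=> E.
suff unit_case (b : nat -> K) I : rnorm (\sum_(i < I | E i) b i *: gap i) = 1 ->
    1 <= 2 * (D0 + C) * rnorm (partial_sum y b I).
  move=> b I; set N := rnorm (\sum_(i < I | E i) _).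
  have [N0|] := ltP 0 N; last first.
    by move/le_trans; apply; rewrite !mulr_ge0 ?addr_ge0 ?rnorm_ge0.
  have := unit_case (fun i => of_real N^-1 * b i) I.
  rewrite partial_sumZ rnormZ rnorm_of_real gtr0_norm ?invr_gt0//.
  have -> : \sum_(i < I | E i) (of_real N^-1 * b i) *: gap i
      = of_real N^-1 *: \sum_(i < I | E i) b i *: gap i.
    by rewrite scaler_sumr; apply: eq_bigr => i _; rewrite scalerA.
  rewrite rnormZ rnorm_of_real gtr0_norm ?invr_gt0// -/N mulVf ?gt_eqF//.
  by move=> /(_ erefl); rewrite mulrCA ler_pdivlMl// mulr1.
set A := rnorm (partial_sum y b I) => sum1.
have A0 : 0 <= A by exact: rnorm_ge0.
pose a i := if E i then b i else 0.
have aA i : (i < I)%N -> rnorm (a i) <= A / e.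
  move=> iI; rewrite /a; case: ifP => _; last by rewrite rnorm0 divr_ge0// ltW.
  by rewrite ler_pdivlMr// mulrC; exact: coord.
have asum : partial_sum gap a I = \sum_(i < I | E i) b i *: gap i.
  rewrite [RHS]big_mkcond; apply: eq_bigr => i _; rewrite /a.
  by case: ifP => // _; rewrite scale0r.
(* The set of large coefficients is controlled through Property P2, applied to
   the coefficients a i and - a i along kappa. *)
have few m (F : pred nat) : (forall i, F i -> delta m <= rnorm (a i)) ->
    (count F (iota 0 I) <= M m)%N.
  move=> Fd; have [al [alk alsum]] := subsequence_coefficients (alternate a) I.*2 kappaS.
  have [g [gS _ gF _]] := @enumerate_increasing F 0 I (fun _ _ => leq0n _) (leq0n I).
  apply: (P2 m al (kappa I.*2) _ (fun s => kappa (g s).*2)).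
  - by move=> i j ij; apply: kappaS; rewrite ltn_double gS.
  - rewrite alsum (partial_sum_alternate (fun j => x (kappa j))).
    by rewrite -[RHS]sum1 -asum.
  - move=> s /gF[Fg gI]; split; first by apply: kappaS; rewrite ltn_double.
    rewrite alk ?ltn_double// rnorm_alternate doubleK; exact: Fd.
have /choice[cls clsP] : forall i, exists m, a i != 0 -> rnorm (a i) < delta 0 ->
    delta m.+1 <= rnorm (a i) < delta m.
  move=> i; have [ai|ai] := eqVneq (a i) 0; first by exists 0%N.
  have [ad|ad] := ltP (rnorm (a i)) (delta 0); last by exists 0%N.
  have ai0 : 0 < rnorm (a i) by rewrite rnorm_gt0.
  by have [m mP] := level_of ai0 ad delta_pow; exists m.
pose small i := (a i != 0) && (rnorm (a i) < delta 0).
pose N := (\max_(i < I) cls i).+1.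
have split_sum : partial_sum gap a I =
    \sum_(i < I | delta 0 <= rnorm (a i)) a i *: gap i
    + \sum_(m < N) (\sum_(i < I | [&& small i, cls i == m & (i < m)%N]) a i *: gap i
        + \sum_(i < I | [&& small i, cls i == m & (m <= i)%N]) a i *: gap i).
  rewrite /partial_sum (bigID (fun i : 'I_I => delta 0 <= rnorm (a i))) /=; congr (_ + _).
  transitivity (\sum_(i < I | small i) a i *: gap i).
    rewrite big_mkcond [RHS]big_mkcond; apply: eq_bigr => i _.
    rewrite /small -ltNge; have [->|] := eqVneq (a i) 0; last by [].
    by rewrite scale0r; case: ifP.
  transitivity (\sum_(m < N) \sum_(i < I | small i && (cls i == m)) a i *: gap i).
    rewrite (exchange_big_dep (fun i : 'I_I => small i))/=; last by move=> m i _ /andP[].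
    apply: eq_bigr => i smi.
    have iN : (cls i < N)%N by rewrite ltnS (leq_bigmax i).
    rewrite (big_pred1 (Ordinal iN))// => m /=.
    by rewrite smi /= -val_eqE eq_sym.
  apply: eq_bigr => m _; rewrite (bigID (fun i : 'I_I => (i < m)%N)) /=.
  congr (_ + _); apply: eq_bigl => i; first by rewrite andbA.
  by rewrite -leqNgt andbA.
have large_part : rnorm (\sum_(i < I | delta 0 <= rnorm (a i)) a i *: gap i) <= D0 * A.
  have := @rnorm_sum_count _ (fun i => delta 0 <= rnorm (a i)) I
    (fun i => a i *: gap i) (A / e * (2 * B)).
  move=> /(_ _)/le_trans; apply.
    by move=> i iI _; rewrite rnormZ ler_pM ?rnorm_ge0 ?aA.
  have -> : D0 * A = (M 0)%:R * (A / e * (2 * B)) by rewrite /D0; ring.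
  apply: ler_wpM2r; first by apply: mulr_ge0; [exact: divr_ge0 A0 (ltW e0)|exact: mulr_ge0].
  by rewrite ler_nat; exact: few.
have small_part (m : 'I_N) :
    rnorm (\sum_(i < I | [&& small i, cls i == m & (i < m)%N]) a i *: gap i
      + \sum_(i < I | [&& small i, cls i == m & (m <= i)%N]) a i *: gap i)
    <= (3 + C * A) / 8 * 2^-1 ^+ m.+1.
  have smallP i : small i -> cls i = m -> delta m.+1 <= rnorm (a i) < delta m.
    by move=> /andP[ai ad] <-; exact: clsP.
  apply: le_trans (rnormD _ _) _.
  have h1 : rnorm (\sum_(i < I | [&& small i, cls i == m & (i < m)%N]) a i *: gap i)
      <= 2^-1 ^+ (m + 4).
    apply: le_trans (delta_small m).
    have := @rnorm_sum_count _ (fun i => [&& small i, cls i == m & (i < m)%N]) I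
      (fun i => a i *: gap i) (delta m * (2 * B)).
    move=> /(_ _)/le_trans; apply.
      move=> i iI /and3P[smi /eqP clsi _]; rewrite rnormZ ler_pM ?rnorm_ge0//.
      by have /andP[_ /ltW] := smallP i smi clsi.
    apply: ler_wpM2r; first by apply: mulr_ge0; [exact: ltW|exact: mulr_ge0].
    by rewrite ler_nat; apply: count_lt => i /and3P[].
  pose F i := [&& small i, cls i == m & (m <= i)%N].
  have h2 : rnorm (\sum_(i < I | F i) b i *: gap i) <= 2^-1 ^+ (m + 4) * (2 + C * A).
    apply: class => [i /and3P[]//||i /and3P[smi /eqP clsi _]].
      by apply: few => i /and3P[smi /eqP clsi _]; have /andP[] := smallP i smi clsi.
    have /andP[_ /ltW] := smallP i smi clsi; rewrite /a; case: ifP => // nE.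
    by move: smi; rewrite /small /a nE eqxx.
  have -> : \sum_(i < I | [&& small i, cls i == m & (m <= i)%N]) a i *: gap i
      = \sum_(i < I | F i) b i *: gap i.
    apply: eq_bigr => i /and3P[smi _ _]; rewrite /a; case: ifP => // nE.
    by move: smi; rewrite /small /a nE eqxx.
  have p4 : 2^-1 ^+ (m + 4) = 2^-1 ^+ m.+1 / 8 :> R by rewrite exprD (exprS _ m); field.
  rewrite p4 in h1 h2; lra.
have C3 : 0 <= (3 + C * A) / 8 by rewrite divr_ge0// addr_ge0// mulr_ge0.
have : 1 <= D0 * A + (3 + C * A) / 8.
  rewrite -[leLHS]sum1 -asum split_sum; apply: le_trans (rnormD _ _) _.
  apply: lerD => //; apply: le_trans (rnorm_sum _ _ _) _.
  apply: le_trans (sum_geometric_le N C3).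
  by apply: ler_sum => m _; exact: small_part.
have := mulr_ge0 C0 A0; have := mulr_ge0 D00 A0; lra.
Qed.

End LevelSets.

(** * The theorem *)

Section Ingredients.
Context {R : realType} {cplx : bool}.
Local Notation K := (scalars R cplx).

Lemma partial_sum_indicator (V : completeNormedModType K) (x : nat -> V) k n :
  partial_sum x (fun j => (j == k)%:R) n = if (k < n)%N then x k else 0.
Proof.
rewrite /partial_sum; have [kn|nk] := ltnP k n.
  rewrite (bigD1 (Ordinal kn))//= eqxx scale1r big1 ?addr0// => i.
  by rewrite -val_eqE /= => /negbTE ->; rewrite scale0r.
by rewrite big1// => i _; rewrite ltn_eqF ?scale0r// (leq_trans (ltn_ord i)).
Qed.

(** Two equal terms would give one vector two expansions. *)
Lemma basic_sequence_neq (V : completeNormedModType K) (z : nat -> V) (i j : nat) :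
  basic_sequence z -> i != j -> z i != z j.
Proof.
move=> [_ zbasis] ij; apply/negP => /eqP zij.
have [a [_ aU]] := zbasis _ (@closed_span_gen _ _ _ z i).
have trE k : expands z (fun n => if (n < k.+1)%N then (n == k)%:R else 0) (z k).
  by have := @expands_truncate _ _ _ z (fun n => (n == k)%:R) k.+1; rewrite partial_sum_delta.
have ei := aU _ (@trE i); have := @trE j; rewrite -zij => /aU; rewrite ei.
move=> /(congr1 (fun f : nat -> K => f i)); rewrite ltnS leqnn eqxx (negbTE ij).
by rewrite if_same => /eqP; rewrite oner_eq0.
Qed.

Lemma row_lower_estimate (X Z : completeNormedModType K) (v : nat -> X) (z : nat -> Z)
    (n L : nat) (C e : R) : (L.*2 <= n)%N -> 0 <= C -> 0 < e ->
  (exists (E : completeNormedModType K) (xt : nat -> E),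
     spreading_model v xt /\ fin_dominated n C z xt) ->
  exists N, forall (kappa : nat -> nat) (l : nat) (a : nat -> K),
    {homo kappa : i j / (i < j)%N} -> (l <= L)%N -> (N <= kappa 0)%N ->
    (forall s, (s < l)%N -> rnorm (a s) <= 1) ->
    rnorm (\sum_(s < l) a s *: (z s.*2 - z s.*2.+1))
      <= C * (rnorm (\sum_(s < l) a s *: (v (kappa s.*2) - v (kappa s.*2.+1))) + e).
Proof.
move=> Ln C0 e0 [E [xt [spread dom]]].
have [N NP] := spreading_differences L spread e0.
exists N => kappa l a kappaS lL Nk a1.
have ln : (l.*2 <= n)%N by rewrite (leq_trans _ Ln)// leq_double.
apply: le_trans (fin_dominated_differences a dom ln) _; rewrite ler_wpM2l//.
by have := NP kappa l a kappaS lL Nk a1; rewrite ler_norml => /andP[]; lra.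
Qed.

End Ingredients.

Theorem theorem3p1 (R : realType) (cplx : bool)
  (X X' Z : completeNormedModType (scalars R cplx))
  (ux : nat -> X) (xn : nat -> nat -> X) (x : nat -> X') (z : nat -> Z)
  (hux : seminormalized_basic ux)
  (hxn : forall n, seminormalized_basic (xn n))
  (hxn_unif : exists c C : R, 0 < c /\ forall n i, c <= rnorm (xn n i) <= C)
  (hx : seminormalized_basic x)
  (hz : seminormalized_basic z)
  (h1 : dominated ux x)
  (h2 : (exists (E : completeNormedModType (scalars R cplx)) (xt : nat -> E),
           spreading_model x xt /\ small_dominated xt z) /\
        property_P2 x)
  (h3 : exists C : R, forall n : nat,
          exists (E : completeNormedModType (scalars R cplx)) (xt : nat -> E),
            spreading_model (xn n) xt /\ fin_dominated n.+1 C z xt) :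
  exists Y : set X,
    [/\ closed_subspace Y,
        exists e : nat -> X, schauder_basis Y e &
        exists T : X -> X,
          bounded_linear_on Y T /\
          forall lambda : scalars R cplx,
            ~ compact_on Y (fun y => T y - lambda *: y)].
Proof.
have [b0 [B [_ xnB]]] := hxn_unif.
have vB n i : rnorm (xn n i) <= B by have /andP[] := xnB n i.
have [_ [b1 [B' [_ xB]]]] := hx.
have {}xB i : rnorm (x i) <= B' by have /andP[] := xB i.
have [[E [xt [spread small]]] P2] := h2.
have [C0 C0P] := h3; pose C := `|C0| + 1.
have Cpos : 0 < C by rewrite ltr_wpDl.
pose zgap s := z s.*2 - z s.*2.+1.
have zgap0 : 0 < rnorm (zgap 0%N).
  by rewrite rnorm_gt0 subr_eq0; apply: basic_sequence_neq; case: hz.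
pose e := rnorm (zgap 0%N) / (2 * C).
have e0 : 0 < e by rewrite divr_gt0// mulr_gt0.
have half_gt0 n : 0 < 2^-1 ^+ n :> R by rewrite exprn_gt0// invr_gt0.
(* Level m of the coefficients is seen through row m, which costs 4 C 2^m; the
   factor 2^-m in eta pays for it, and the other one sums to a small total. *)
have Ce : 0 < 1 + C * e by rewrite ltr_wpDr// mulr_ge0// ltW.
pose eta m : R := 2^-1 ^+ (m + 4) * 2^-1 ^+ m / (1 + C * e).
have eta0 m : 0 < eta m by rewrite divr_gt0// mulr_gt0.
have B'0 : 0 <= B' by apply: le_trans (rnorm_ge0 _) (xB 0%N).
have ex_delta m : exists d : R, [/\ 0 < d, d <= 2^-1 ^+ m,
    m%:R * (d * (2 * B')) <= 2^-1 ^+ (m + 4) &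
    forall l (a : nat -> scalars R cplx), (forall s, (s < l)%N -> rnorm (a s) <= d) ->
      rnorm (\sum_(s < l) a s *: (xt s.*2 - xt s.*2.+1))
        <= eta m * (1 + rnorm (\sum_(s < l) a s *: zgap s))].
  have [d1 d10 d1P] := small_dominated_differences small (eta0 m).
  pose d2 : R := 2^-1 ^+ (m + 4) / (m%:R * (2 * B') + 1).
  have den : 0 < m%:R * (2 * B') + 1 by rewrite ltr_wpDl// !mulr_ge0.
  have d20 : 0 < d2 by rewrite divr_gt0.
  exists (Num.min d1 (Num.min d2 (2^-1 ^+ m))); split.
  - by rewrite !lt_min d10 d20 half_gt0.
  - by rewrite !ge_min lexx !orbT.
  - apply: le_trans (_ : m%:R * (d2 * (2 * B')) <= _).
      by rewrite ler_wpM2l// ler_wpM2r ?mulr_ge0// !ge_min lexx !orbT.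
    rewrite mulrCA /d2 mulrAC ler_pdivrMr// ler_wpM2l ?(ltW (half_gt0 _))//.
    by rewrite lerDl.
  - move=> l a ad; apply: d1P => s sl; apply: le_trans (ad s sl) _.
    by rewrite ge_min lexx.
have [delta deltaP] := choice ex_delta.
have delta0 m : 0 < delta m by case: (deltaP m).
have delta_pow m : delta m <= 2^-1 ^+ m by case: (deltaP m).
have delta1 m : delta m <= 1.
  by apply: le_trans (delta_pow m) _; rewrite exprn_ile1 ?invr_ge0// invf_le1// ler1n.
have [M MP] := choice (fun m => property_P2_count P2 (delta0 m)).
(* P2 bounds the size of level m by M m.+1; one more index makes l 0 positive,
   which the coordinate estimate from row 0 requires. *)
pose l m := (M m.+1).+1.
(* A combination of l m differences involves 2 (l m) terms of z. *)
pose v m := xn (l m).*2.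
have /choice[Nrow NrowP] : forall m, exists N, forall (kappa : nat -> nat) k (a : nat -> scalars R cplx),
    {homo kappa : i j / (i < j)%N} -> (k <= l m)%N -> (N <= kappa 0)%N ->
    (forall s, (s < k)%N -> rnorm (a s) <= 1) ->
    rnorm (\sum_(s < k) a s *: zgap s)
      <= C * (rnorm (\sum_(s < k) a s *: (v m (kappa s.*2) - v m (kappa s.*2.+1))) + e).
  move=> m.
  apply: (@row_lower_estimate _ _ X Z (v m) z (l m).*2.+1 (l m) C e) => //.
  - exact: ltW.
  - have [F [ft [Fs Fd]]] := C0P (l m).*2; exists F, ft; split => // a.
    apply: le_trans (Fd a) _; rewrite ler_wpM2r ?rnorm_ge0//.
    by rewrite /C (le_trans (ler_norm _))// lerDl.
have [Nx NxP] := choice (fun m => spreading_differences (l m) spread (half_gt0 (m + 4))).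
pose g t := (\sum_(m < t.+1) (Nrow m + Nx m))%N.
have gP m t : (m <= t)%N -> (Nrow m + Nx m <= g t)%N.
  by move=> mt; rewrite /g (bigD1 (Ordinal (mt : (m < t.+1)%N)))//= leq_addr.
have e40 : 0 < e / 4 by rewrite divr_gt0.
have [kappa [kappaS kappa_g u_select]] := selection (fun m i => vB (l m).*2 i) row_of l g e40.
pose u t := v (row_of t) (kappa t.*2) - v (row_of t) (kappa t.*2.+1).
(* e is half of || z_0 - z_1 || / C, the lower bound for the spreading model of a row *)
have u_low i : 4 * (e / 4) <= rnorm (u (i * i)%N).
  have row0 : row_of (i * i) = 0%N by rewrite -[X in row_of X]addn0 row_of_block.
  pose t := (i * i)%N.
  have := NrowP 0%N (fun j => kappa (t.*2 + j)%N) 1%N (fun=> 1).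
  rewrite !big_ord1 !scale1r /= addn0 addn1 => H.
  have : rnorm (zgap 0%N) <= C * (rnorm (u t) + e).
    rewrite /u row0; apply: H => //.
    - by move=> j k jk; apply: kappaS; rewrite ltn_add2l.
    - by apply: leq_trans (kappa_g t); apply: leq_trans (gP 0%N t (leq0n _)); exact: leq_addr.
    - by move=> s _; rewrite rnorm1.
  have -> : rnorm (zgap 0%N) = C * (e + e) by rewrite /e; field; rewrite gt_eqF.
  by rewrite ler_pM2l//; lra.
have u_up t : rnorm (u t) <= 2 * B.
  by rewrite (le_trans (rnormB _ _))// mulr2n mulrDl mul1r lerD// vB.
pose y := diagonal u.
have y_coord (b : nat -> scalars R cplx) I i : (i < I)%N -> e / 4 * rnorm (b i) <= rnorm (partial_sum y b I).
  exact: (diagonal_coordinate e40 u_select (ltn0Sn _) u_low).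
have y_const (b : nat -> scalars R cplx) m I : (m <= I)%N ->
    rnorm (partial_sum y b m) <= 2 * rnorm (partial_sum y b I).
  exact: (diagonal_constant e40 u_select (ltn0Sn _) u_low).
have y_row (b : nat -> scalars R cplx) n I (F : pred nat) : (forall i, F i -> (n <= i)%N) ->
    (count F (iota 0 I) <= l n)%N ->
    rnorm (\sum_(i < I | F i) b i *: u (i * i + n)%N)
      <= 4 * 2 ^+ n * rnorm (partial_sum y b I).
  exact: (diagonal_row e40 u_select (ltn0Sn _) u_low).
have y_up i : rnorm (y i) <= 2 * (2 * B) by exact: rnorm_diagonal_le.
pose xgap i := x (kappa i.*2) - x (kappa i.*2.+1).
(* The spreading models of x and of row m are reached along the positions of F,
   and z mediates between them. *)
have class m (F : pred nat) (b : nat -> scalars R cplx) I : (forall i, F i -> (m <= i)%N) ->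
    (count F (iota 0 I) <= M m.+1)%N -> (forall i, F i -> rnorm (b i) <= delta m) ->
    rnorm (\sum_(i < I | F i) b i *: xgap i)
      <= 2^-1 ^+ (m + 4) * (2 + 4 * C * rnorm (partial_sum y b I)).
  move=> Fm cF bF; set A := rnorm (partial_sum y b I).
  have A0 : 0 <= A by exact: rnorm_ge0.
  have [Im|mI] := ltnP I m.
    rewrite big_pred0 ?rnorm0.
      by rewrite mulr_ge0 ?(ltW (half_gt0 _))// addr_ge0// mulr_ge0// mulr_ge0// ltW.
    by move=> i; apply/negP => /Fm; rewrite leqNgt (ltn_trans (ltn_ord i) Im).
  have cl : (count F (iota 0 I) <= l m)%N by exact: leqW.
  have [h [hS hm hF hsum]] := enumerate_increasing Fm mI.
  set k := count F (iota 0 I) in cF cl hF hsum.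
  pose c s := b (h s).
  have cd s : (s < k)%N -> rnorm (c s) <= delta m by move=> /hF[Fh _]; exact: bF.
  have c1 s : (s < k)%N -> rnorm (c s) <= 1 by move=> sk; exact: le_trans (cd s sk) (delta1 m).
  pose t s := (h s * h s + m)%N.
  have tS s s' : (s < s')%N -> (t s < t s')%N.
    by move=> ss'; rewrite ltn_add2r; have := hS _ _ ss'; nia.
  have dbl (q : nat -> nat) : (forall s s', (s < s')%N -> (q s < q s')%N) ->
      {homo (fun j => kappa ((q j./2).*2 + odd j)%N) : i j / (i < j)%N}.
    move=> qS i j ij; apply: kappaS; have := odd_double_half i; have := odd_double_half j.
    case: (ltngtP i./2 j./2) => [/qS|ji|->] hi hj; [|lia|].
      by case: (odd i); case: (odd j); lia.
    by move: hi hj; case: (odd i); case: (odd j); lia.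
  have z_le : rnorm (\sum_(s < k) c s *: zgap s) <= C * (4 * 2 ^+ m * A + e).
    have := NrowP m _ k c (dbl _ tS) cl _ c1; rewrite /= addn0 => H.
    apply: le_trans (H _) _.
      apply: leq_trans (kappa_g _); apply: leq_trans (gP m _ _); first exact: leq_addr.
      exact: leq_addl.
    rewrite ler_pM2l// lerD2r; have := y_row b m I F Fm cl.
    rewrite (hsum X (fun i => b i *: u (i * i + m)%N)).
    congr (rnorm _ <= _); apply: eq_bigr => s _.
    rewrite /u row_of_block; last by have := hm s; lia.
    by rewrite ?odd_double /= ?odd_double /= ?doubleK ?uphalf_double ?addn0 ?addn1.
  have x_le : rnorm (\sum_(s < k) c s *: xgap (h s)) <=
      2^-1 ^+ (m + 4) + eta m * (1 + rnorm (\sum_(s < k) c s *: zgap s)).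
    have [_ _ _ /(_ k c cd) small_c] := deltaP m.
    have := NxP m _ k c (dbl _ hS) cl _ c1; rewrite /= addn0 => H.
    have {H} : `|rnorm (\sum_(s < k) c s *: xgap (h s))
        - rnorm (\sum_(s < k) c s *: (xt s.*2 - xt s.*2.+1))| <= 2^-1 ^+ (m + 4).
      apply: le_trans (H _); last first.
        apply: leq_trans (kappa_g _); apply: leq_trans (gP m _ (hm 0%N)); exact: leq_addl.
      rewrite le_eqVlt; apply/orP; left; apply/eqP; congr `|rnorm _ - _|.
      apply: eq_bigr => s _.
      by rewrite /xgap ?odd_double /= ?odd_double /= ?doubleK ?uphalf_double ?addn0 ?addn1.
    by rewrite ler_norml => /andP[_]; lra.
  rewrite (hsum X' (fun i => b i *: xgap i)); apply: le_trans x_le _.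
  have z2 := ler_wpM2l (ltW (eta0 m)) z_le.
  have etaE : eta m * (1 + C * (4 * 2 ^+ m * A + e))
      = 2^-1 ^+ (m + 4) * (2^-1 ^+ m + 4 * C * A / (1 + C * e)).
    rewrite /eta; have -> : 2 ^+ m = (2^-1 ^+ m)^-1 :> R by rewrite exprVn invrK.
    by field; rewrite !gt_eqF.
  have le1 : 2^-1 ^+ m <= 1 :> R by rewrite exprn_ile1 ?invr_ge0// invf_le1// ler1n.
  have le2 : 4 * C * A / (1 + C * e) <= 4 * C * A.
    by rewrite ler_pdivrMr// ler_peMr ?mulr_ge0 ?(ltW Cpos)// lerDl mulr_ge0// ltW.
  have := ler_wpM2l (ltW (half_gt0 (m + 4)%N)) (lerD le1 le2).
  by move: z2 etaE; rewrite !mulrDr !mulr1; lra.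
have [D D0 DP] := @level_domination _ _ X X' y x kappa delta M (e / 4) B' (4 * C)
  e40 (mulr_ge0 (ler0n _ 4) (ltW Cpos)) kappaS xB delta0 delta_pow
  (fun m => let: And4 _ _ h _ := deltaP m in h) y_coord MP class.
have [Cd CdP] := h1.
pose tau i := if odd i then 0 else ux (kappa i.*2) - ux (kappa i.*2.+1).
have [ux_basic [cu [Cu [cu0 cuP]]]] := hux.
have ux0 i : ux i != 0.
  by rewrite -rnorm_gt0; have /andP[h _] := cuP i; exact: lt_le_trans cu0 h.
have [Cux [Cux0 uxC]] := basis_constant ux_basic ux0.
apply: (@noncompact_operator _ _ X y tau 2 (`|Cd| * D) (2 * (2 * B)) (e / 4) (cu / Cux)) => //.
- by rewrite mulr_ge0.
- move=> b I; pose c i := if odd i then 0 else b i.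
  have [al [_ alsum]] := subsequence_coefficients (alternate c) I.*2 kappaS.
  have gapE (V : completeNormedModType (scalars R cplx)) (w : nat -> V) : partial_sum w al (kappa I.*2)
      = \sum_(i < I | ~~ odd i) b i *: (w (kappa i.*2) - w (kappa i.*2.+1)).
    rewrite alsum (partial_sum_alternate (fun j => w (kappa j))) [RHS]big_mkcond.
    by apply: eq_bigr => i _; rewrite /c; case: (odd i); rewrite ?scale0r.
  have -> : partial_sum tau b I = partial_sum ux al (kappa I.*2).
    rewrite gapE [RHS]big_mkcond; apply: eq_bigr => i _; rewrite /tau.
    by case: (odd i); rewrite ?scaler0.
  apply: le_trans (CdP (kappa I.*2) (fun i : 'I__ => al i)) _.
  apply: le_trans (ler_wpM2r (rnorm_ge0 _) (ler_norm Cd)) _.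
  rewrite -mulrA ler_wpM2l//.
  have := DP (fun i => ~~ odd i) b I; rewrite -gapE; exact.
- by move=> i oi; rewrite /tau oi.
- by rewrite divr_gt0.
- move=> i j ij; rewrite /tau !odd_double /=.
  (* The first of the four basis vectors is a partial sum of the difference. *)
  pose ind k0 : nat -> scalars R cplx := fun k => (k == k0)%:R.
  pose ks := (kappa i.*2.*2, kappa i.*2.*2.+1, kappa j.*2.*2, kappa j.*2.*2.+1).
  have k12 : (ks.1.1.1 < ks.1.1.2)%N by apply: kappaS.
  have k23 : (ks.1.1.2 < ks.1.2)%N by apply: kappaS; lia.
  have k34 : (ks.1.2 < ks.2)%N by apply: kappaS.
  pose al k := (ind ks.1.1.1 k - ind ks.1.1.2 k) - (ind ks.1.2 k - ind ks.2 k).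
  have alE n : partial_sum ux al n =
      ((if (ks.1.1.1 < n)%N then ux ks.1.1.1 else 0) - (if (ks.1.1.2 < n)%N then ux ks.1.1.2 else 0))
      - ((if (ks.1.2 < n)%N then ux ks.1.2 else 0) - (if (ks.2 < n)%N then ux ks.2 else 0)).
    by rewrite !partial_sumB !partial_sum_indicator.
  have := uxC al ks.1.1.1.+1 ks.2.+1 (leqW (ltn_trans k12 (ltn_trans k23 k34))).
  rewrite !alE !ltnS !leqnn.
  rewrite [(ks.1.1.2 <= ks.1.1.1)%N]leqNgt k12 /=.
  rewrite [(ks.1.2 <= ks.1.1.1)%N]leqNgt (ltn_trans k12 k23) /=.
  rewrite [(ks.2 <= ks.1.1.1)%N]leqNgt (ltn_trans k12 (ltn_trans k23 k34)) /=.
  rewrite (ltnW (ltn_trans k12 (ltn_trans k23 k34))) (ltnW (ltn_trans k23 k34)) (ltnW k34).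
  rewrite !subr0 /= => h; rewrite ler_pdivrMr// mulrC.
  by apply: le_trans h; have /andP[] := cuP (kappa i.*2.*2).
Qed.
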